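(* Let $d\in(0,\frac12)$, $p\in[1,2)$, and let $L^d$ be a fractional L\'evy process of bounded $p$-variation. Let $(I,\mu,\sigma)$ be a strongly proper triple with state space transform $f$ and friction coefficient $\lambda>0$. Then $$\{X^{f,\lambda}(L^d,\tau,W):\tau\in\mathbb R,\ W\in M(\Omega,I)\}\subseteq\mathcal S(I,\mu,\sigma,L^d),$$ i.e. for every $\tau\in\mathbb R$ and every map $W:\Omega\to I$ the process $X^{f,\lambda}(L^d,\tau,W)$ is a pathwise solution of $dX_t=\mu(X_t)\,dt+\sigma(X_t)\,dL^d_t$, $t\in\mathbb R$.
   Context: All random objects live on a complete probability space $(\Omega,\mathcal F,P)$. Fractional L\'evy process. A two-sided L\'evy process is $L_t=L^1_t1_{\{t\ge0\}}+L^2_{-t-}1_{\{t<0\}}$, $t\in\mathbb R$, where $L^1,L^2$ are two independent copies of the same L\'evy process. Let $L$ be a zero-mean two-sided L\'evy process with $E[L(1)^2]<\infty$ and without Brownian component, $d\in(0,\frac12)$. The fractional L\'evy process (FLP) is $L^d_t:=\frac{1}{\Gamma(d+1)}\int_{-\infty}^\infty[(t-s)_+^d-(-s)_+^d]\,L(ds)$ ($L^2(\Omega)$-integral), always taken in its continuous modification $L^d_t=\frac{1}{\Gamma(d)}\int_{\mathbb R}[(t-s)_+^{d-1}-(-s)_+^{d-1}]L(s)\,ds$ (improper Riemann integral). $p$-variation. For $g:[a,b]\to\mathbb R$, $v_p(g,[a,b]):=\sup\sum_i|g(x_i)-g(x_{i-1})|^p$, the supremum over all subdivisions of $[a,b]$.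 $L^d$ is of bounded $p$-variation if almost surely its paths have finite $p$-variation on all compact intervals. $\mathfrak W^{\mathrm{con}}_p(\mathbb R)$ is the set of continuous $g:\mathbb R\to\mathbb R$ with $v_p(g,[s,t])<\infty$ for all compact $[s,t]\subset\mathbb R$. Integrals with respect to $L^d$ are pathwise Riemann--Stieltjes integrals. Strongly proper triples. $(I,\mu,\sigma)$ is strongly proper if: (P1) $I=(a,b)\subseteq\mathbb R$ is an open interval, $-\infty\le a<b\le\infty$, and $\mu,\sigma:I\to\mathbb R$ are continuous; (P2) there is a strictly decreasing function $\psi$ on $I$, absolutely continuous with respect to Lebesgue measure, with $\psi=\mu/\sigma$ on $I\setminus Z(\sigma)$, where $Z(\sigma)$ is the zero set of $\sigma$, and $\lim_{x\nearrow b}\psi(x)=-\infty$, $\lim_{x\searrow a}\psi(x)=+\infty$; (P3) there is $\lambda>0$ with $\sigma\psi'=-\lambda$ Lebesgue-a.e. on $I$; (P4) the inverse $\psi^{-1}:\mathbb R\to I$ is differentiable and $(\psi^{-1})'$ is Lipschitz continuous on compacts. The (unique) $\lambda$ is the friction coefficient, and $f:\mathbb R\to I$, $f(x):=\psi^{-1}(-\lambda x)$, is the state space transform. Ornstein--Uhlenbeck operator. $\mathcal L^{d,\lambda}_t:=\int_{-\infty}^te^{-\lambda(t-s)}\,dL^d_s$ (pathwise improper Riemann--Stieltjes integral), and for $\tau,z,t\in\mathbb R$, $\mathfrak L^\lambda_t(L^d,\tau,z):=\mathcal L^{d,\lambda}_t-e^{-\lambda(t-\tau)}\mathcal L^{d,\lambda}_\tau+e^{-\lambda(t-\tau)}z$.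 For $\tau\in\mathbb R$, $z\in I$: $X^{f,\lambda}_t(L^d,\tau,z):=f\big(\mathfrak L^\lambda_t(L^d,\tau,f^{-1}(z))\big)$, $t\in\mathbb R$. $M(\Omega,I)$ denotes all mappings $\Omega\to I$, and $X^{f,\lambda}(L^d,\tau,W)$ is defined $\omega$-wise by inserting $z=W(\omega)$. Pathwise solutions. $\mathcal S(I,\mu,\sigma,L^d)$ is the set of processes $X=(X_t)_{t\in\mathbb R}$ (families of maps $X_t:\Omega\to\mathbb R$, no measurability required) such that for almost all $\omega$: $X\in\mathfrak W^{\mathrm{con}}_p(\mathbb R)$, the image of $X$ is contained in $I$, and for all $s\le t$, $\sigma\circ X$ is Riemann--Stieltjes integrable with respect to $L^d$ on $[s,t]$ and $X_t-X_s=\int_s^t\mu(X_u)\,du+\int_s^t\sigma(X_u)\,dL^d_u$. *)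

(* Defs.v *)
From HB Require Import structures.
From mathcomp Require Import all_boot all_order all_algebra.
From mathcomp Require Import all_classical all_reals all_analysis.

Set Implicit Arguments.
Unset Strict Implicit.
Unset Printing Implicit Defensive.

Import Order.TTheory GRing.Theory Num.Theory.
Import numFieldNormedType.Exports.

Local Open Scope classical_set_scope.
Local Open Scope ring_scope.

(* A stochastic process is a map [X : R -> T -> R], time first; its path at
   [w] is [X ^~ w]. *)

Section Paths.
Context {R : realType}.
Implicit Types (g h : R -> R) (p t : R) (v : R).

Definition p_variation (p : R) g (s t : R) : \bar R :=
  ereal_sup [set (\sum_(i < size l)
      `|g (nth t (s :: l) i.+1) - g (nth t (s :: l) i)| `^ p)%:E
    | l in itv_partition s t].

Definition Wcon (p : R) : set (R -> R) :=
  [set g | continuous g /\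
           forall s t, s <= t -> (p_variation p g s t < +oo)%E].

Definition RS_sum h g (s t : R) (l : seq R) (xi : nat -> R) : R :=
  \sum_(i < size l)
    h (xi i) * (g (nth t (s :: l) i.+1) - g (nth t (s :: l) i)).

(* [v] is the integral of [h] with respect to [g] over [s, t] (for s <= t),
   as the limit of the tagged Riemann-Stieltjes sums as the mesh tends to 0. *)
Definition is_RSint h g (s t : R) (v : R) : Prop :=
  forall e : R, 0 < e -> exists2 delta : R, 0 < delta &
    forall (l : seq R) (xi : nat -> R),
      itv_partition s t l ->
      (forall i, (i < size l)%N ->
         nth t (s :: l) i <= xi i <= nth t (s :: l) i.+1 /\
         nth t (s :: l) i.+1 - nth t (s :: l) i < delta) ->
      `|RS_sum h g s t l xi - v| < e.

Definition RS_integrable h g (s t : R) : Prop := exists v, is_RSint h g s t v.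

(* The default value 0 is returned when [h] is not integrable. *)
Definition RSint h g (s t : R) : R := xget 0 [set v | is_RSint h g s t v].

(* Improper Riemann integral over an open interval ]a, b[, both ends of which
   may be singular or infinite: the two ends are approached independently. *)
Definition is_improper_Rint_itv h (a b : \bar R) (v : R) : Prop :=
  forall e : R, 0 < e -> exists x0 y0 : R,
    [/\ (a < x0%:E)%E, x0 < y0, (y0%:E < b)%E &
        forall x y, (a < x%:E)%E -> x <= x0 -> y0 <= y -> (y%:E < b)%E ->
          exists2 u, is_RSint h id x y u & `|u - v| < e].

(* Improper Riemann integral over the line of a function with finitely many
   singularities [cs] (necessarily listed in increasing order). *)
Definition is_improper_Rint h (v : R) : Prop :=
  exists (cs : seq R) (vs : nat -> R),
    let es := -oo%E :: rcons (map EFin cs) +oo%E in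
    (forall i, (i <= size cs)%N ->
       is_improper_Rint_itv h (nth +oo%E es i) (nth +oo%E es i.+1) (vs i)) /\
    v = \sum_(i < (size cs).+1) vs i.

Definition cadlag (x : R -> R) : Prop :=
  (forall t, 0 <= t -> x u @[u --> t^'+] --> x t) /\
  (forall t, 0 < t -> cvg (x u @[u --> t^'-])).

(* The classical epsilon-delta absolute continuity, on every compact
   subinterval of the interval [I]. *)
Definition loc_abs_continuous (I : set R) g : Prop :=
  forall x y : R, I x -> I y -> forall e : R, 0 < e -> exists2 delta : R, 0 < delta &
    forall (n : nat) (l r : nat -> R),
      (forall i, (i < n)%N -> [/\ x <= l i, l i <= r i & r i <= y]) ->
      trivIset `I_n (fun i => [set` `]l i, r i[]) ->
      \sum_(i < n) (r i - l i) < delta ->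
      \sum_(i < n) `|g (r i) - g (l i)| < e.

End Paths.

Section Levy.
Context {R : realType} {disp : measure_display} {T : measurableType disp}.
Variable P : probability T R.
Implicit Types X Y L : R -> T -> R.

Definition independent_increments X : Prop :=
  forall (n : nat) (t : nat -> R) (B : nat -> set R),
    0 <= t 0 -> (forall i, t i <= t i.+1) -> (forall i, measurable (B i)) ->
    fine (P [set w | forall i, (i < n)%N -> B i (X (t i.+1) w - X (t i) w)]) =
    \prod_(i < n) fine (P [set w | B i (X (t i.+1) w - X (t i) w)]).

Definition stationary_increments X : Prop :=
  forall (s h : R) (B : set R), 0 <= s -> 0 <= h -> measurable B ->
    P [set w | B (X (s + h) w - X s w)] = P [set w | B (X h w - X 0 w)].

(* Only the restriction of [X] to nonnegative times matters. Stochastic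
   continuity follows from the last two clauses. *)
Definition is_levy X : Prop :=
  [/\ forall t : R, 0 <= t -> measurable_fun setT (X t),
      {ae P, forall w, X 0 w = 0},
      independent_increments X,
      stationary_increments X &
      {ae P, forall w, cadlag (X ^~ w)}].

Definition finite_dim_event X (n : nat) (t : nat -> R) (B : nat -> set R) :
  set T := [set w | forall i, (i < n)%N -> B i (X (t i) w)].

Definition same_law X Y : Prop :=
  forall n t B, (forall i, 0 <= t i) -> (forall i, measurable (B i)) ->
    P (finite_dim_event X n t B) = P (finite_dim_event Y n t B).

Definition independent_processes X Y : Prop :=
  forall n t B m u C,
    (forall i, 0 <= t i) -> (forall i, measurable (B i)) ->
    (forall i, 0 <= u i) -> (forall i, measurable (C i)) ->
    P (finite_dim_event X n t B `&` finite_dim_event Y m u C) =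
    (P (finite_dim_event X n t B) * P (finite_dim_event Y m u C))%E.

Definition is_two_sided_levy L : Prop :=
  exists L1 L2 : R -> T -> R,
    [/\ is_levy L1, is_levy L2, same_law L1 L2, independent_processes L1 L2 &
        forall t w, L t w =
          if 0 <= t then L1 t w else lim (L2 u w @[u --> (- t)^'-])].

(* Levy-Khintchine representation of the law of [X], with drift [gamma],
   Gaussian variance [s2], Levy measure [nu] and truncation function
   1_{|x| <= 1}: real and imaginary parts of E[exp(iuX)] = exp(re + i im). *)
Definition has_levy_triplet (X : T -> R) (gamma s2 : R)
    (nu : {measure set (measurableTypeR R) -> \bar R}) : Prop :=
  [/\ 0 <= s2, nu [set 0] = 0%E,
      (\int[nu]_x (Num.min 1 (x ^+ 2))%:E < +oo)%E &
      forall u : R,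
        let re := - (s2 * u ^+ 2) / 2 + \int[nu]_x (cos (u * x) - 1) in
        let im := gamma * u +
          \int[nu]_x (sin (u * x) - u * x * (`|x| <= 1)%R%:R) in
        ('E_P[fun w => (cos (u * X w))%R] = (expR re * cos im)%:E)%E /\
        ('E_P[fun w => (sin (u * X w))%R] = (expR re * sin im)%:E)%E].

Definition no_brownian_component L : Prop :=
  exists gamma nu, has_levy_triplet (L 1) gamma 0 nu.

(* The step function with data [s] is the sum of the c 1_{]l, r]} for
   (c, (l, r)) in [s], where l <= r. *)
Definition step_fun (s : seq (R * (R * R))) (x : R) : R :=
  \sum_(e <- s) e.1 * (e.2.1 < x <= e.2.2)%R%:R.

Definition step_integral L (s : seq (R * (R * R))) (w : T) : R :=
  \sum_(e <- s) e.1 * (L e.2.2 w - L e.2.1 w).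

(* [Y] is (a version of) the L2(Omega)-integral of [k] with respect to [L]. *)
Definition is_L2_integral L (k : R -> R) (Y : T -> R) : Prop :=
  measurable_fun setT Y /\
  exists s : nat -> seq (R * (R * R)),
    [/\ forall n, all (fun e => e.2.1 <= e.2.2) (s n),
        (\int[lebesgue_measure]_x ((step_fun (s n) x - k x) ^+ 2)%:E)%E
          @[n --> \oo] --> 0%E &
        ('E_P[fun w => ((step_integral L (s n) w - Y w) ^+ 2)%R])%E
          @[n --> \oo] --> 0%E].

Definition Gamma (x : R) : R :=
  \int[lebesgue_measure]_(t in `]0, +oo[) (t `^ (x - 1) * expR (- t)).

(* [x_+ ^ c]; since 0 `^ c = 0 for c != 0, it vanishes on x <= 0 also when
   c < 0. *)
Definition pos_pow (x c : R) : R := (Num.max x 0) `^ c.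

(* The driving process of a fractional Levy process: centred, square
   integrable, without Brownian component. *)
Definition flp_driver L : Prop :=
  [/\ is_two_sided_levy L,
      forall t, ('E_P[L t] = 0)%E,
      ('E_P[fun w => (L 1 w ^+ 2)%R] < +oo)%E &
      no_brownian_component L].

(* [Ld] is the continuous modification, given pathwise by an improper Riemann
   integral, of the L2-integral defining the fractional Levy process. *)
Definition is_flp (d : R) L (Ld : R -> T -> R) : Prop :=
  [/\ flp_driver L,
      forall t, exists2 Y,
        is_L2_integral L (fun s => pos_pow (t - s) d - pos_pow (- s) d) Y &
        {ae P, forall w, Ld t w = (Gamma (d + 1))^-1 * Y w},
      {ae P, forall w, continuous (Ld ^~ w)} &
      {ae P, forall w, forall t, exists2 v,
        is_improper_Rint (fun s =>
          (pos_pow (t - s) (d - 1) - pos_pow (- s) (d - 1)) * L s w) v &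
        Ld t w = (Gamma d)^-1 * v}].

Definition bounded_p_variation (p : R) X : Prop :=
  {ae P, forall w, forall s t, s <= t ->
    (p_variation p (X ^~ w) s t < +oo)%E}.

End Levy.

Section StronglyProper.
Context {R : realType}.
Implicit Types (a b : \bar R) (mu sigma psi f : R -> R) (lam : R).

Definition open_itv a b : set R := [set x | (a < x%:E)%E /\ (x%:E < b)%E].

(* The inverse of a function injective on [A], defined on its image. *)
Definition inv_on (A : set R) f : R -> R := 'pinv_(fun=> 0) A f.

(* [(]a, b[, mu, sigma)] is strongly proper, with witness [psi] and friction
   coefficient [lam]; both are uniquely determined on the interval by
   [mu] and [sigma]. *)
Record strongly_proper a b mu sigma psi lam : Prop := StronglyProper {
  sp_itv : (a < b)%E ;
  sp_mu_cont : {in open_itv a b, continuous mu} ;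
  sp_sigma_cont : {in open_itv a b, continuous sigma} ;
  sp_psi_decr : forall x y, open_itv a b x -> open_itv a b y ->
    x < y -> psi y < psi x ;
  sp_psi_ac : loc_abs_continuous (open_itv a b) psi ;
  sp_psiE : forall x, open_itv a b x -> sigma x != 0 ->
    psi x = mu x / sigma x ;
  sp_psi_right : forall M, exists2 c, open_itv a b c &
    forall x, open_itv a b x -> c < x -> psi x < M ;
  sp_psi_left : forall M, exists2 c, open_itv a b c &
    forall x, open_itv a b x -> x < c -> M < psi x ;
  sp_lam_gt0 : 0 < lam ;
  sp_friction : {ae lebesgue_measure, forall x, open_itv a b x ->
    derivable psi x 1 /\ sigma x * derive1 psi x = - lam} ;
  sp_inv_derivable : forall y : R, derivable (inv_on (open_itv a b) psi) y 1 ;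
  sp_inv_lipschitz : forall K : set R, compact K ->
    [lipschitz derive1 (inv_on (open_itv a b) psi) x | x in K]
}.

Definition state_space_transform a b psi lam : R -> R :=
  fun x => inv_on (open_itv a b) psi (- lam * x).

(* The improper Riemann-Stieltjes integral of exp(- lam (t - s)) dg_s over
   ]-oo, t]. *)
Definition OU_integral (lam : R) (g : R -> R) (t : R) : R :=
  lim (RSint (fun s => expR (- (lam * (t - s)))) g r t @[r --> -oo]).

Definition OU_operator (lam : R) (g : R -> R) (tau z t : R) : R :=
  OU_integral lam g t - expR (- (lam * (t - tau))) * OU_integral lam g tau
  + expR (- (lam * (t - tau))) * z.

End StronglyProper.

Section Solutions.
Context {R : realType} {disp : measure_display} {T : measurableType disp}.

Definition transformed_OU (f : R -> R) (lam : R) (Ld : R -> T -> R) (tau : R)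
    (W : T -> R) : R -> T -> R :=
  fun t w => f (OU_operator lam (Ld ^~ w) tau (inv_on setT f (W w)) t).

Definition solutions (P : probability T R) (p : R) (a b : \bar R)
    (mu sigma : R -> R) (Ld : R -> T -> R) : set (R -> T -> R) :=
  [set X | {ae P, forall w,
    [/\ Wcon p (X ^~ w),
        forall t, open_itv a b (X t w) &
        forall s t, s <= t ->
          RS_integrable (fun u => sigma (X u w)) (Ld ^~ w) s t /\
          X t w - X s w =
            \int[lebesgue_measure]_(u in `[s, t]) mu (X u w) +
            RSint (fun u => sigma (X u w)) (Ld ^~ w) s t]}].

End Solutions.

(* Main.v *)
Require Import Defs.
From HB Require Import structures.
From mathcomp Require Import all_boot all_order all_algebra.
From mathcomp Require Import all_classical all_reals all_analysis.
From mathcomp Require Import measurable_realfun.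
From mathcomp Require Import ring lra.
Import Order.TTheory GRing.Theory Num.Theory.
Import numFieldNormedType.Exports.
Local Open Scope classical_set_scope.
Local Open Scope ring_scope.

Set Implicit Arguments.
Unset Strict Implicit.
Unset Printing Implicit Defensive.

(* Pathwise, let g be a path of L^d. Integration by parts turns the Ornstein-Uhlenbeck process into
   Y = g + A with A continuously differentiable and A' = - lam Y, provided that exp(lam s) g(s) is
   small at -oo. Since f' is locally Lipschitz and g has finite p-variation with p < 2, the
   first-order Taylor errors f(Y_v) - f(Y_u) - f'(Y_x) (Y_v - Y_u) sum to o(1) over fine tagged
   partitions; hence the Riemann-Stieltjes sums of f'(Y) against g = Y - A converge, with limit
   f(Y_t) - f(Y_s) - \int f'(Y) A'. The friction equation sigma psi' = - lam holds on a dense set,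
   so by continuity sigma o f = f' and mu o f (y) = - lam y f'(y) everywhere, which makes f(Y) a
   solution.
   The growth of g at -oo is a probabilistic fact: step integrals against L satisfy the Ito
   isometry, so E (L^d_t - L^d_s)^2 <= C |t - s|^(1 + 2 d), and a chaining argument on dyadic points
   of all the intervals [- n - 1, - n] at once gives |g(t)| <= D exp(lam |t| / 2) for t <= 0. *)


(** Existence of the integrals is not taken from Young's theory: each one is identified through a
    candidate primitive F. The error committed by F in one tagged cell is at most e times the length
    of the cell plus the p-variation it carries once split at its tag, and these bounds add up to e
    times (t - s plus the total p-variation). Integration by parts and the chain rule are two
    choices of F. The bound |a|^2 <= eta |a|^p for small a is where p < 2 enters. The rate lam / 2
    is one choice below lam: it lets exp(lam s) g(s) decay like exp(lam s / 2). The exceptional null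
    set depends only on L^d, which is why an arbitrary map W can be inserted afterwards. On the
    probabilistic side, L at negative times is a left limit; it agrees a.s. with a plain value of
    the second Levy process, and completeness of P makes it measurable. The exponent 1 + 2 d exceeds
    1, as chaining requires: the 2^k increments of level k have total second moment of order 2^(- 2
    d k), and half of this exponent is spent on the weights. *)

(** * Riemann-Stieltjes sums along paths of finite p-variation *)

Section RiemannStieltjes.
Context {R : realType}.
Implicit Types (s t u v x y z e p del c : R) (l : seq R) (xi : nat -> R) (w : R -> R -> R -> R).

(** Heine-Cantor with only [x] confined to the segment: the near-covering form of compactness gives
    a radius uniform in [x], and [y] may leave the segment. *)
Lemma segment_unif_continuous (g : R -> R) (s t e : R) :
  continuous g -> 0 < e -> exists2 del, 0 < del &
    forall x y, s <= x <= t -> `|x - y| < del -> `|g x - g y| <= e.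
Proof.
move=> cg e0.
have := @segment_compact R s t; rewrite compact_near_coveringP => K.
have := K R (0^'+) (fun del x => forall y, `|x - y| < del -> `|g x - g y| <= e) _.
have F : forall x, s <= x <= t -> \forall x' \near x & del \near 0^'+,
  forall y, `|x' - y| < del -> `|g x' - g y| <= e.
  move=> x _; have /cvgrPdist_lt/(_ _ (divr_gt0 e0 (ltr0n _ 2))) := cg x.
  rewrite -nbhs_nearE => /nbhs_ballP [r /= r0 rP].
  exists (ball x (r/2), [set del | del < r/2]) => /=.
    split; first by apply: nbhsx_ballx; rewrite divr_gt0.
    by apply: nbhs_right_lt; rewrite divr_gt0.
  move=> [x' del] /= [bx' ld] y xy.
  have hx' : ball x r x' by move: bx'; rewrite /ball /=; lra.
  have hy : ball x r y.
    move: bx' xy ld; rewrite /ball /= => h1 h2 h3.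
    rewrite (_ : x - y = (x - x') + (x' - y)); last by ring.
    by rewrite (le_lt_trans (ler_normD _ _))//; lra.
  move: (rP _ hx') (rP _ hy) => /= h1 h2.
  rewrite (_ : g x' - g y = (g x - g y) - (g x - g x')); last by ring.
  by rewrite (le_trans (ler_normB _ _))//; lra.
move=> /(_ _)[].
  by move=> x; rewrite /= in_itv/=; exact: F.
move=> r /= r0 rP; exists (r/2); first by rewrite divr_gt0.
move=> x y sxt xy; apply: (rP (r/2)) => //=.
- by rewrite sub0r normrN gtr0_norm; [rewrite ltr_pdivrMr//; lra|rewrite divr_gt0].
- by rewrite divr_gt0.
Qed.

Lemma segment_bounded (g : R -> R) s t : continuous g ->
  exists2 K, 0 < K & forall x, s <= x <= t -> `|g x| <= K.
Proof.
move=> cg; have [st|ts] := leP s t; last first.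
  by exists 1 => // x /andP[sx xt]; lra.
have cn : {within `[s, t], continuous (fun x => `|g x|)}.
  apply: continuous_subspaceT => x; apply: continuous_comp; first exact: cg.
  exact: norm_continuous.
have [c _ cP] := EVT_max st cn.
exists (`|g c| + 1); first by rewrite ltr_wpDl.
by move=> x sxt; rewrite (le_trans (cP x _))// ?in_itv// lerDl.
Qed.

Lemma is_derive_continuous (F f : R -> R) :
  (forall x, is_derive x 1 F (f x)) -> continuous F.
Proof.
move=> dF x; apply: differentiable_continuous; apply/derivable1_diffP.
by have [] := dF x.
Qed.

Lemma is_deriveBZ (F G : R -> R) (f g c x : R) :
  is_derive x 1 F f -> is_derive x 1 G g ->
  is_derive x 1 (fun z => F z - c * G z) (f - c * g).
Proof. by move=> dF dG; exact: (is_deriveB dF (is_deriveZ c dG)). Qed.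

Lemma is_derive_incr_le (F f : R -> R) (K u v : R) :
  (forall x, is_derive x 1 F (f x)) -> u <= v ->
  (forall x, u <= x <= v -> `|f x| <= K) ->
  `|F v - F u| <= K * (v - u).
Proof.
move=> dF uv fK.
have [|c cuv ->] := @MVT_segment R F f u v uv (fun x _ => dF x).
  by apply: continuous_subspaceT; exact: is_derive_continuous dF.
rewrite normrM (ger0_norm (_ : 0 <= v - u)) ?subr_ge0//.
by rewrite ler_wpM2r ?subr_ge0// fK//; rewrite in_itv in cuv.
Qed.

(** Recursion on the list of nodes replaces the [nth]-indexed sums of the definitions, so that facts
    about partitions go by induction; the tags shift along with the nodes. *)
Fixpoint tagged_sum (w : R -> R -> R -> R) s l xi : R :=
  if l is x :: l' then w s (xi 0%N) x + tagged_sum w x l' (xi \o succn) else 0.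

Lemma tagged_sumE w s t l xi :
  \sum_(i < size l) w (nth t (s :: l) i) (xi i) (nth t (s :: l) i.+1) =
  tagged_sum w s l xi.
Proof.
elim: l s xi => [|x l IH] s xi /=; first by rewrite big_ord0.
rewrite big_ord_recl /=; congr (_ + _); rewrite -IH.
by apply: eq_bigr => i _.
Qed.

Lemma tagged_sumB w1 w2 s l xi :
  tagged_sum (fun u x v => w1 u x v - w2 u x v) s l xi =
  tagged_sum w1 s l xi - tagged_sum w2 s l xi.
Proof. by elim: l s xi => [|x l IH] s xi /=; rewrite ?subrr// IH; ring. Qed.

Lemma tagged_sumD w1 w2 s l xi :
  tagged_sum (fun u x v => w1 u x v + w2 u x v) s l xi =
  tagged_sum w1 s l xi + tagged_sum w2 s l xi.
Proof. by elim: l s xi => [|x l IH] s xi /=; rewrite ?addr0// IH; ring. Qed.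

Lemma tagged_sumZ c w s l xi :
  tagged_sum (fun u x v => c * w u x v) s l xi = c * tagged_sum w s l xi.
Proof. by elim: l s xi => [|x l IH] s xi /=; rewrite ?mulr0// IH mulrDr. Qed.

Lemma tagged_sum_telescope (F : R -> R) s l xi :
  tagged_sum (fun u _ v => F v - F u) s l xi = F (last s l) - F s.
Proof. by elim: l s xi => [|x l IH] s xi /=; rewrite ?subrr// IH; ring. Qed.

(** The premises under which [is_RSint] tests a tagged partition, bundled. *)
Definition fine_tags (del : R) s t l xi := itv_partition s t l /\
  (forall i, (i < size l)%N ->
     nth t (s :: l) i <= xi i <= nth t (s :: l) i.+1 /\
     nth t (s :: l) i.+1 - nth t (s :: l) i < del).

Lemma fine_tags_cons del s t x l xi : fine_tags del s t (x :: l) xi ->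
  [/\ s < x, s <= xi 0%N <= x, x - s < del, x <= t &
      fine_tags del x t l (xi \o succn)].
Proof.
move=> [pl H]; have [/andP[/= h1 h2] h3] := conj (H 0%N isT).1 (H 0%N isT).2.
have [/= /andP[sx _] _] := pl.
have pl' := itv_partition_cons pl.
split => //; [by rewrite h1|exact: itv_partition_le pl'|].
by split => // i il; apply: (H i.+1).
Qed.

(** [s0] stays put while the induction moves [s] to the right, so the cellwise bound can be assumed
    once, on a fixed interval. *)
Lemma tagged_sum_norm_le w w' s0 del s t l xi : s0 <= s ->
  fine_tags del s t l xi ->
  (forall u x v, s0 <= u -> u <= x -> x <= v -> v <= t -> u < v -> v - u < del ->
     `|w u x v| <= w' u x v) ->
  `|tagged_sum w s l xi| <= tagged_sum w' s l xi.
Proof.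
move=> + + H; elim: l s xi => [|x l IH] s xi s0s ft /=; first by rewrite normr0.
have [sx /andP[sxi xix] xs xt ft'] := fine_tags_cons ft.
rewrite (le_trans (ler_normD _ _))// lerD ?H//.
by apply: IH => //; lra.
Qed.

Lemma p_variation_ge p (g : R -> R) s t l : itv_partition s t l ->
  ((tagged_sum (fun u _ v => `|g v - g u| `^ p) s l (fun=> 0))%:E <=
   p_variation p g s t)%E.
Proof.
move=> pl; apply: ereal_sup_ubound => /=; exists l => //.
by rewrite -(@tagged_sumE _ s t).
Qed.

(** The integrand is evaluated at the tag [x], so errors are governed by the increments of [g] on
    either side of it rather than by [g v - g u]. *)
Definition tag_variation p (g : R -> R) u x v : R :=
  `|g x - g u| `^ p + `|g v - g x| `^ p.

Lemma tag_variation_ge0 p g u x v : 0 <= tag_variation p g u x v.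
Proof. by rewrite addr_ge0 ?powR_ge0. Qed.

Lemma tagged_sum_id (w : R -> R -> R) s l xi :
  tagged_sum (fun u _ v => w u v) s l xi = tagged_sum (fun u _ v => w u v) s l (fun=> 0).
Proof.
have H xi' : tagged_sum (fun u _ v => w u v) s l xi =
    tagged_sum (fun u _ v => w u v) s l xi'.
  by elim: l s xi xi' => //= x l IH s xi xi'; rewrite (IH _ _ (xi' \o succn)).
exact: H.
Qed.

(* Refine the partition by the tags that are not already partition points. *)
Lemma tag_variation_le p (g : R -> R) del s t l xi : p != 0 ->
  fine_tags del s t l xi -> exists2 l', itv_partition s t l' &
    tagged_sum (tag_variation p g) s l xi =
    tagged_sum (fun u _ v => `|g v - g u| `^ p) s l' (fun=> 0).
Proof.
move=> p0; elim: l s xi => [|x l IH] s xi ft /=.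
  by exists [::] => //; case: ft.
have [sx /andP[sxi xix] xs xt ft'] := fine_tags_cons ft.
have [l' pl' ->] := IH _ _ ft'; rewrite /tag_variation.
(* Partitions increase strictly, so a tag equal to an end of its cell is not inserted; the
   corresponding term is a power of 0, which vanishes since [p != 0]. *)
have [/eqP xis|xis] := eqVneq (xi 0%N) s.
  exists (x :: l'); first by case: pl' => ? ?; split => //=; rewrite sx.
  by rewrite /= (eqP xis) subrr normr0 powR0// add0r tagged_sum_id.
have [/eqP xis'|xis'] := eqVneq (xi 0%N) x.
  exists (x :: l'); first by case: pl' => ? ?; split => //=; rewrite sx.
  by rewrite /= (eqP xis') subrr normr0 powR0// addr0 [in RHS]tagged_sum_id.
exists (xi 0%N :: x :: l').
  case: pl' => ? ?; split => //=.
  by rewrite !lt_def xis sxi eq_sym xis' xix/=.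
by rewrite /= addrA [in RHS]tagged_sum_id.
Qed.

Lemma tagged_sum_variation_le p (g : R -> R) del s t l xi : p != 0 ->
  (p_variation p g s t < +oo)%E -> fine_tags del s t l xi ->
  tagged_sum (tag_variation p g) s l xi <= fine (p_variation p g s t).
Proof.
move=> p0 pv ft; have [l' pl' ->] := tag_variation_le g p0 ft.
rewrite -lee_fin fineK; first exact: p_variation_ge.
rewrite fin_numElt pv andbT (lt_le_trans _ (p_variation_ge p g pl'))//.
exact: ltNyr.
Qed.

(** Without such partitions the limit in [is_RSint] would be vacuous; uniqueness of the integral
    rests on this. The nodes advance by [del / 2], with left-end tags. *)
Lemma exists_fine_tags del s t : 0 < del -> s <= t ->
  exists l xi, fine_tags del s t l xi.
Proof.
move=> d0 st.
have [n nP] : exists n : nat, t - s < n%:R * (del / 2).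
  have [n nP] := ltr_add_invr (ltr01 : (0:R) < 1).
  exists (Num.truncn ((t - s) / (del / 2))).+1.
  rewrite -ltr_pdivrMr ?divr_gt0//; exact: truncnS_gt.
elim: n s st nP => [|n IH] s st nP; first by lra.
move: st; rewrite le_eqVlt => /predU1P[<-|st].
  by exists [::], (fun=> 0); split => //; split.
have [ts|ts] := leP (t - s) (del / 2).
  exists [:: t], (fun=> s); split; first by split => //=; rewrite st.
  by move=> [|]//= _; split; lra.
have h1 : s + del / 2 <= t by lra.
have h2 : t - (s + del / 2) < n%:R * (del / 2).
  by move: nP; rewrite -natr1; lra.
have [l [xi [[pl1 pl2] H]]] := IH _ h1 h2.
exists (s + del / 2 :: l), (fun i => if i is i'.+1 then xi i' else s).
split; first by split => //=; rewrite pl1 andbT; lra.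
by move=> [|i] /= il; [split; lra|exact: H].
Qed.

Lemma is_RSint_unique (h g : R -> R) s t v1 v2 : s <= t ->
  is_RSint h g s t v1 -> is_RSint h g s t v2 -> v1 = v2.
Proof.
move=> st i1 i2; apply/eqP/negPn/negP => v12.
have e0 : 0 < `|v1 - v2| / 2 by rewrite divr_gt0// normr_gt0 subr_eq0.
have [d1 d10 H1] := i1 _ e0; have [d2 d20 H2] := i2 _ e0.
have dm0 : 0 < Num.min d1 d2 by rewrite lt_min d10 d20.
have [l [xi [pl H]]] := exists_fine_tags dm0 st.
have /(H1 _ _ pl) h1 i : (i < size l)%N ->
         nth t (s :: l) i <= xi i <= nth t (s :: l) i.+1 /\
         nth t (s :: l) i.+1 - nth t (s :: l) i < d1.
  by move=> /H[]; rewrite lt_min => ? /andP[].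
have /(H2 _ _ pl) h2 i : (i < size l)%N ->
         nth t (s :: l) i <= xi i <= nth t (s :: l) i.+1 /\
         nth t (s :: l) i.+1 - nth t (s :: l) i < d2.
  by move=> /H[]; rewrite lt_min => ? /andP[].
suff : `|v1 - v2| < `|v1 - v2| by rewrite ltxx.
rewrite {1}(_ : v1 - v2 = (RS_sum h g s t l xi - v2) - (RS_sum h g s t l xi - v1)); last by ring.
apply: le_lt_trans (ler_normB _ _) _.
by move: h1 h2; set a := `|_ - v1|; set b := `|_ - v2|; set c := `|_|; lra.
Qed.

Lemma RSintE (h g : R -> R) s t v : s <= t ->
  is_RSint h g s t v -> RSint h g s t = v.
Proof.
move=> st iv; apply: (is_RSint_unique st _ iv).
by apply: xgetPex; exists v.
Qed.

(** Lengths telescope to [t - s] and the tag variations sum to at most the p-variation, so a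
    cellwise error proportional to both is small in total. This yields existence and value of the
    integral at once. *)
Lemma is_RSint_local (h g F : R -> R) s t p : s <= t -> p != 0 ->
  (p_variation p g s t < +oo)%E ->
  (forall e, 0 < e -> exists2 del, 0 < del &
    forall u x v, s <= u -> u <= x -> x <= v -> v <= t -> u < v -> v - u < del ->
    `|h x * (g v - g u) - (F v - F u)| <= e * ((v - u) + tag_variation p g u x v)) ->
  is_RSint h g s t (F t - F s).
Proof.
move=> st p0 pv H e e0.
set V := fine (p_variation p g s t).
have V0 : 0 <= V.
  have [l [xi ft]] := exists_fine_tags ltr01 st.
  apply: le_trans (tagged_sum_variation_le p0 pv ft).
  apply: le_trans (normr_ge0 _) (@tagged_sum_norm_le (tag_variation p g) (tag_variation p g) s 1 s t l xi (lexx s) ft _).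
  by move=> u x v *; rewrite ger0_norm ?tag_variation_ge0.
(* The extra 1 keeps the divisor positive and the final estimate strict when [t - s] and [V]
   vanish. *)
have C0 : 0 < (t - s) + V + 1 by lra.
have [del d0 Hd] := H _ (divr_gt0 e0 C0).
exists del => // l xi pl tl; have ft : fine_tags del s t l xi by [].
rewrite /RS_sum (@tagged_sumE (fun u x v => h x * (g v - g u)) s t).
have -> : F t - F s = tagged_sum (fun u _ v => F v - F u) s l xi.
  by rewrite tagged_sum_telescope; case: pl => _ /eqP->.
rewrite -tagged_sumB.
apply: le_lt_trans (tagged_sum_norm_le (lexx s) ft Hd) _.
rewrite tagged_sumZ tagged_sumD (@tagged_sum_telescope id).
rewrite mulrAC ltr_pdivrMr// ltr_pM2l//.
have := tagged_sum_variation_le p0 pv ft; rewrite -/V.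
by case: pl => _ /eqP->; lra.
Qed.

Lemma is_RSint_by_parts (phi phi' g B : R -> R) s t p : s <= t -> p != 0 ->
  (p_variation p g s t < +oo)%E -> continuous g -> continuous phi' ->
  (forall x, is_derive x 1 phi (phi' x)) ->
  (forall x, is_derive x 1 B (phi' x * g x)) ->
  is_RSint phi g s t (phi t * g t - phi s * g s - (B t - B s)).
Proof.
move=> st p0 pv cg cphi' dphi dB.
pose F x := phi x * g x - B x.
rewrite (_ : _ - (B t - B s) = F t - F s); last by rewrite /F; ring.
apply: (is_RSint_local st p0 pv) => e e0.
have [K K0 KP] := segment_bounded s t cphi'.
have [del d0 dP] := segment_unif_continuous s t cg (divr_gt0 e0 K0).
exists del => // u x v su ux xv vt uv vu.
(* [B - c * phi] has derivative [phi' * (g - c)], small where [g] is close to [c]. The cell is cut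
   at its tag, with [c = g v] on the right part and [c = g u] on the left part. *)
have D c (y : R) : is_derive y 1 (fun z => B z - c * phi z) (phi' y * (g y - c)).
  by rewrite mulrBr (mulrC _ c); exact: is_deriveBZ.
have E c a b : s <= a -> a <= b -> b <= t ->
    (forall y, a <= y <= b -> `|g y - c| <= e / K) ->
    `|B b - c * phi b - (B a - c * phi a)| <= e * (b - a).
  move=> sa ab bt H; apply: (is_derive_incr_le (D c)) => // y /andP[ay yb].
  rewrite normrM mulrC (_ : e = e / K * K); last by rewrite divfK// gt_eqF.
  by rewrite ler_pM// ?H ?KP; lra.
have E1 := E (g v) x v (le_trans su ux) xv vt _.
have E2 := E (g u) u x su ux (le_trans xv vt) _.
rewrite (_ : _ - (F v - F u) = (B v - g v * phi v - (B x - g v * phi x)) +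
  (B x - g u * phi x - (B u - g u * phi u))); last by rewrite /F; ring.
rewrite (le_trans (ler_normD _ _))//.
rewrite (@le_trans _ _ (e * (v - x) + e * (x - u)))//.
  apply: lerD; [apply: E1|apply: E2] => y /andP[y1 y2]; apply: dP; try lra.
    by rewrite ler0_norm; lra.
  by rewrite ger0_norm; lra.
have := tag_variation_ge0 p g u x v.
by rewrite -mulrDr ler_pM2l//; lra.
Qed.

(** Write the square of [a] as its power [2 - p] times its power [p]; as [2 - p] is positive, the
    first factor is at most [eta] for small [a]. *)
Lemma powR_sqr_le p (eta a : R) : p < 2 -> 0 <= eta -> 0 <= a ->
  a <= eta `^ (2 - p)^-1 -> a ^+ 2 <= eta * a `^ p.
Proof.
move=> p2 eta0 a0 ae; have [->|an0] := eqVneq a 0.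
  by rewrite expr0n/= mulr_ge0// powR_ge0.
rewrite -powR_mulrn// (_ : 2%:R = (2 - p) + p); last by rewrite subrK.
rewrite powRD ?an0 ?implybT// ler_wpM2r ?powR_ge0//.
have p20 : 0 < 2 - p by lra.
rewrite -[X in _ <= X](powRr1 eta0) -[X in _ `^ X <= _]mulr1 mulr1 -[X in _ <= _ `^ X](mulVf (lt0r_neq0 p20)) powRrM.
by apply: ge0_ler_powR; rewrite ?nnegrE ?powR_ge0// ltW.
Qed.

Lemma is_derive_taylor_le (f f' : R -> R) (L B u x v : R) : 0 <= L ->
  (forall y, is_derive y 1 f (f' y)) ->
  (forall y z, `|y| <= B -> `|z| <= B -> `|f' y - f' z| <= L * `|y - z|) ->
  `|u| <= B -> `|x| <= B -> `|v| <= B ->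
  `|f' x * (v - u) - (f v - f u)| <= L * (`|x - u| + `|v - x|) ^+ 2.
Proof.
move=> L0 df lf; wlog uv : u v / u <= v => [H|] uB xB vB.
  have [/H|/ltW/H] := leP u v; first exact.
  move=> /(_ vB xB uB); congr (_ <= L * _ ^+ 2).
    by rewrite -normrN; congr `|_|; ring.
  by rewrite addrC distrC; congr (_ + _); rewrite distrC.
have D (y : R) : is_derive y 1 (fun z => f z - f' x * z) (f' y - f' x).
  rewrite -[X in _ - X]mulr1; apply: is_deriveBZ; exact: is_derive_id.
rewrite -normrN (_ : - (f' x * (v - u) - (f v - f u)) = f v - f' x * v - (f u - f' x * u)); last by ring.
have xu0 := normr_ge0 (x - u); have vx0 := normr_ge0 (v - x).
have /ler_normlP[? ?] := lexx `|x - u|; have /ler_normlP[? ?] := lexx `|v - x|.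
have vu : v - u <= `|x - u| + `|v - x| by lra.
apply: le_trans (is_derive_incr_le (K := L * (`|x - u| + `|v - x|)) D uv _) _.
  move=> y /andP[uy yv]; apply: le_trans (lf _ _ _ xB) _.
    by move: uB vB; rewrite !ler_norml => /andP[? ?] /andP[? ?]; lra.
  by rewrite ler_wpM2l// ler_norml; lra.
by rewrite expr2 mulrA ler_wpM2l// mulr_ge0// addr_ge0.
Qed.

(** Here [a] is an increment of the rough path and [b] one of its C1 correction over a length [h];
    the square of [b] is of order [h ^ 2], hence below [e * h] on short cells. *)
Lemma powR_sqr_incr_le p (a b K h e : R) : 0 < e -> 0 < K -> 0 <= h ->
  `|a| ^+ 2 <= e * `|a| `^ p -> `|b| <= K * h -> h <= e / K ^+ 2 ->
  `|a + b| ^+ 2 <= 2 * e * (`|a| `^ p + h).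
Proof.
move=> e0 K0 h0 ae bK he.
have b2 : `|b| ^+ 2 <= e * h.
  apply: (@le_trans _ _ ((K * h) ^+ 2)).
    by rewrite ler_pXn2r// nnegrE mulr_ge0// ltW.
  by rewrite exprMn mulrA ler_wpM2r// mulrC -ler_pdivlMr// exprn_gt0.
apply: (@le_trans _ _ (2 * `|a| ^+ 2 + 2 * `|b| ^+ 2)); last by lra.
rewrite -!normrX !ger0_norm ?sqr_ge0//.
by have := sqr_ge0 (a - b); rewrite !expr2; lra.
Qed.

(** Formally dg = dY - A' dx, so the candidate primitive of [f' \o Y] against [g] is [f \o Y]
    corrected by a primitive [M] of the smooth part. *)
Lemma is_RSint_chain (f f' g A A' M : R -> R) s t p : s <= t -> 0 < p < 2 ->
  (p_variation p g s t < +oo)%E -> continuous g -> continuous A' -> continuous f' ->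
  (forall x, is_derive x 1 f (f' x)) ->
  (forall B, exists2 K, 0 < K & forall x y, `|x| <= B -> `|y| <= B ->
     `|f' x - f' y| <= K * `|x - y|) ->
  (forall x, is_derive x 1 A (A' x)) ->
  (forall x, is_derive x 1 M (f' (g x + A x) * A' x)) ->
  let Y x := g x + A x in
  is_RSint (f' \o Y) g s t (f (Y t) - f (Y s) - (M t - M s)).
Proof.
move=> st /andP[p0 p2] pv cg cA' cf' df lf dA dM Y.
have cA := is_derive_continuous dA.
have cY : continuous Y by move=> x; apply: cvgD; [exact: cg|exact: cA].
pose F x := f (Y x) - M x.
rewrite (_ : _ - (M t - M s) = F t - F s); last by rewrite /F; ring.
apply: (is_RSint_local st (lt0r_neq0 p0) pv) => e e0.
have [K K0 KP] := segment_bounded s t cA'.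
have [B B0 BP] := segment_bounded s t cY.
have [L L0 LP] := lf B.
(* The square of the two-sided increment of [Y] costs [4 * e1], so the Taylor error is
   [4 * L * e1 = e / 2] per unit; the other half of [e] pays for replacing [M] by [f' (Y x) * A]. *)
set e1 := e / (8 * L).
have e10 : 0 < e1 by rewrite divr_gt0// mulr_gt0.
have [d1 d10 d1P] := segment_unif_continuous s t cg (powR_gt0 (2 - p)^-1 e10).
have [d2 d20 d2P] := segment_unif_continuous s t
  (fun x => continuous_comp (cY x) (cf' (Y x)) : {for x, continuous (f' \o Y)})
  (divr_gt0 e0 (mulr_gt0 (ltr0n R 2) K0)).
have d30 : 0 < e1 / K ^+ 2 by rewrite divr_gt0// exprn_gt0.
(* Below [d1] increments of [g] meet the threshold of [powR_sqr_le], below [d2] the integrand is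
   nearly constant on a cell, and the third bound is the one [powR_sqr_incr_le] asks of the
   length. *)
exists (Num.min (Num.min d1 d2) (e1 / K ^+ 2)).
  by rewrite !lt_min d10 d20.
move=> u x v su ux xv vt uv; rewrite !lt_min => /andP[/andP[vd1 vd2] vd3].
have ut : u <= t by apply: le_trans vt; apply: ltW.
have sx : s <= x := le_trans su ux; have xt : x <= t := le_trans xv vt.
have P2 : `|M v - M u - f' (Y x) * (A v - A u)| <= e / 2 * (v - u).
  have D (y : R) : is_derive y 1 (fun z => M z - f' (Y x) * A z) ((f' (Y y) - f' (Y x)) * A' y).
    by rewrite mulrBl; exact: is_deriveBZ.
  rewrite (_ : _ - _ * _ = M v - f' (Y x) * A v - (M u - f' (Y x) * A u)); last by ring.
  apply: (is_derive_incr_le D (ltW uv)) => y /andP[uy yv].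
  have syt : s <= y <= t by rewrite (le_trans su)// (le_trans yv).
  rewrite normrM (_ : e / 2 = e / (2 * K) * K); last by field; rewrite gt_eqF.
  rewrite ler_pM//; last exact: KP.
  by apply: d2P => //; clear -ux xv uy yv vd2; rewrite ltr_norml; lra.
have P1 : `|f' (Y x) * (Y v - Y u) - (f (Y v) - f (Y u))| <=
    L * (`|Y x - Y u| + `|Y v - Y x|) ^+ 2.
  apply: (is_derive_taylor_le (B := B) (ltW L0) df LP); apply: BP; apply/andP; split => //.
  by rewrite (le_trans su)// ltW.
have Q u1 v1 : u <= u1 -> u1 <= v1 -> v1 <= v ->
    `|Y v1 - Y u1| ^+ 2 <= 2 * e1 * (`|g v1 - g u1| `^ p + (v1 - u1)).
  move=> uu1 uv1 vv1.
  have [h1 h2 h3 h4] : [/\ s <= v1 <= t, s <= u1, `|v1 - u1| < d1 & v1 - u1 <= e1 / K ^+ 2].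
    by clear -su uu1 uv1 vv1 vt vd1 vd3; split; rewrite ?ltr_norml; lra.
  rewrite (_ : Y v1 - Y u1 = (g v1 - g u1) + (A v1 - A u1)); last by rewrite /Y; ring.
  apply: (powR_sqr_incr_le (K := K)) => //; first by rewrite subr_ge0.
    by apply: powR_sqr_le => //; [exact: ltW|exact: d1P].
  apply: (is_derive_incr_le dA) => // y /andP[y1 y2]; apply: KP.
  by rewrite (le_trans h2)// (le_trans y2)//; case/andP: h1.
have := Q u x (lexx u) ux xv; have := Q x v ux xv (lexx v).
rewrite (_ : _ - (F v - F u) = (f' (Y x) * (Y v - Y u) - (f (Y v) - f (Y u))) +
   (M v - M u - f' (Y x) * (A v - A u))); last by rewrite /F /Y/=; ring.
move: P1 P2; rewrite /tag_variation.
move: (f' (Y x) * _ - _) (M v - M u - _) => P1 P2.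
have -> : e = 8 * (L * e1) by rewrite /e1; field; rewrite gt_eqF.
move: (`|Y x - Y u|) (`|Y v - Y x|) (`|g x - g u| `^ p) (`|g v - g x| `^ p)
  (powR_ge0 `|g x - g u| p) (powR_ge0 `|g v - g x| p) => a b c1 c2 c10 c20.
clear -L0 e10 uv c10 c20 => h1 h2 h3 h4.
apply: le_trans (ler_normD _ _) _; apply: le_trans (lerD h1 h2) _.
have h5 : (a + b) ^+ 2 <= 4 * e1 * (c1 + c2 + (v - u)).
  have := sqr_ge0 (a - b); move: h3 h4; rewrite !expr2; lra.
have h6 : L * (a + b) ^+ 2 <= L * (4 * e1 * (c1 + c2 + (v - u))).
  by rewrite ler_pM2l.
have := mulr_ge0 (mulr_ge0 (ltW L0) (ltW e10)) (addr_ge0 c10 c20).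
by lra.
Qed.

Lemma p_variation_lty (X g : R -> R) p s t c : s <= t -> p != 0 -> 0 <= c ->
  (forall u v, s <= u -> u < v -> v <= t ->
     `|X v - X u| `^ p <= c * (`|g v - g u| `^ p + (v - u))) ->
  (p_variation p g s t < +oo)%E -> (p_variation p X s t < +oo)%E.
Proof.
move=> st p0 c0 H pv.
apply: (@le_lt_trans _ _ (c * (fine (p_variation p g s t) + (t - s)))%:E); last exact: ltry.
apply: ge_ereal_sup => _ /= [l pl <-]; rewrite lee_fin.
pose w u (_ v : R) := c * (`|g v - g u| `^ p + (v - u)).
apply: (@le_trans _ _ (\sum_(i < size l)
    w (nth t (s :: l) i) 0 (nth t (s :: l) i.+1))).
  apply: ler_sum => i _; have [pp _] := pl; apply: H.
  - by apply: itv_partition_nth_ge pl; rewrite ltnS ltnW.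
  - exact: (pathP t pp).
  - exact: (@itv_partition_nth_le _ _ s t l i.+1 (ltn_ord i) pl).
rewrite (@tagged_sumE w s t l (fun=> 0)) tagged_sumZ tagged_sumD.
rewrite (@tagged_sum_telescope id) ler_wpM2l// (_ : last s l = t); last by case: pl => _ /eqP.
rewrite lerD2r -lee_fin fineK; first exact: p_variation_ge.
rewrite fin_numElt pv andbT (lt_le_trans _ (p_variation_ge p g pl))//.
exact: ltNyr.
Qed.

End RiemannStieltjes.


(** * The friction equation and the state space transform *)

Section StateSpaceTransform.
Context {R : realType}.
Implicit Types (x y z : R) (a b : \bar R).

Lemma open_itv_nbhs a b x : open_itv a b x -> \forall y \near x, open_itv a b y.
Proof.
move=> [ax xb]; rewrite -nbhs_nearE; near=> y; split; near: y.
  exact: (open_ereal_gt' ax).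
exact: (open_ereal_lt' xb).
Unshelve. all: end_near. Qed.

Lemma open_itv_convex a b x y z : open_itv a b x -> open_itv a b z ->
  x <= y <= z -> open_itv a b y.
Proof.
move=> [ax xb] [az zb] /andP[xy yz]; split.
  by rewrite (lt_le_trans ax)// lee_fin.
by rewrite (le_lt_trans _ zb)// lee_fin.
Qed.

Lemma open_itv_ball a b x : open_itv a b x ->
  exists2 r, 0 < r & forall y, `|x - y| <= r -> open_itv a b y.
Proof.
move=> /open_itv_nbhs; rewrite -nbhs_nearE => /nbhs_ballP[r /= r0 H].
exists (r / 2); first by rewrite divr_gt0.
by move=> y xy; apply: H; rewrite /ball/= (le_lt_trans xy)// ltr_pdivrMr//; lra.
Qed.

(** A nonzero value would persist on a ball inside the interval, and a null set contains no ball. *)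
Lemma ae_continuous_eq0 a b (h : R -> R) :
  (forall x, open_itv a b x -> {for x, continuous h}) ->
  {ae lebesgue_measure, forall x, open_itv a b x -> h x = 0} ->
  forall x, open_itv a b x -> h x = 0.
Proof.
move=> ch [N [mN N0 HN]] x Ix; apply/eqP/negPn/negP => hx0.
have : \forall y \near x, h y != 0 /\ open_itv a b y.
  rewrite -nbhs_nearE; near=> y; split; near: y; last exact: open_itv_nbhs.
  have /cvgrPdist_lt/(_ `|h x|) := ch _ Ix.
  rewrite normr_gt0 => /(_ hx0); apply: filterS => y; apply: contraTneq => ->.
  by rewrite subr0 ltxx.
rewrite -nbhs_nearE => /nbhs_ballP[r /= r0 H].
have xrN : ball x r `<=` N.
  move=> y xry; apply: HN => /= hy0; have [hy Iy] := H _ xry.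
  by move: hy; rewrite hy0 ?eqxx.
have nb : (@lebesgue_measure R).-negligible (ball x r) by exists N.
have mb : measurable (ball x r) by rewrite ball_itv; exact: measurable_itv.
have := @measure_negligible _ _ R (@lebesgue_measure R) _ mb nb.
move=> h0; have := etrans (esym (lebesgue_measure_ball x (ltW r0))) h0.
by move=> [] /eqP; rewrite gt_eqF// mulrn_wgt0.
Unshelve. all: end_near. Qed.

Lemma loc_abs_continuous_continuous a b (g : R -> R) :
  loc_abs_continuous (open_itv a b) g ->
  forall x, open_itv a b x -> {for x, continuous g}.
Proof.
move=> ac x Ix; have [r r0 rP] := open_itv_ball Ix.
apply/cvgrPdist_lt => /= e e0.
have Ir1 : open_itv a b (x - r) by apply: rP; rewrite opprB addrC subrK gtr0_norm.
have Ir2 : open_itv a b (x + r) by apply: rP; rewrite opprD addrA subrr sub0r normrN gtr0_norm.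
have [del d0 dP] := ac _ _ Ir1 Ir2 e e0.
have K y z : x - r <= y -> y <= z -> z <= x + r -> z - y < del -> `|g z - g y| < e.
  (* Absolute continuity tested on a family of one interval. *)
  move=> h1 h2 h3 h4; have := dP 1%N (fun=> y) (fun=> z).
  rewrite !big_ord1; apply => //.
  by move=> i j /= ; case: i => //; case: j.
rewrite -nbhs_nearE; apply/nbhs_ballP; exists (Num.min r del) => /=.
  by rewrite lt_min r0.
move=> y; rewrite /ball/= lt_min => /andP[yr yd].
have {yr} /ltr_normlP[yr1 yr2] := yr; have {yd} /ltr_normlP[yd1 yd2] := yd.
have [xy|yx] := leP x y; first by rewrite distrC; apply: K; lra.
by apply: K; lra.
Qed.

Variables (a b : \bar R) (mu sigma psi : R -> R) (lam : R).
Hypothesis sp : strongly_proper a b mu sigma psi lam.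
Let I := open_itv a b.
Let q := inv_on I psi.
Let f := state_space_transform a b psi lam.
Let f' x := - lam * derive1 q (- lam * x).

Let cpsi x : I x -> {for x, continuous psi}.
Proof. exact: loc_abs_continuous_continuous (sp_psi_ac sp) x. Qed.

Lemma psi_surj : set_surj I setT psi.
Proof.
move=> M _ /=.
have [c2 Ic2 Hc2] := sp_psi_right sp M; have [c1 Ic1 Hc1] := sp_psi_left sp M.
(* The limit clauses give inequalities only strictly beyond [c2] and strictly before [c1], hence a
   small step past each inside the open interval. *)
have [r2 r20 Hr2] := open_itv_ball Ic2; have [r1 r10 Hr1] := open_itv_ball Ic1.
have Ix2 : I (c2 + r2) by apply: Hr2; rewrite opprD addrA subrr sub0r normrN gtr0_norm.
have Ix1 : I (c1 - r1) by apply: Hr1; rewrite opprB addrC subrK gtr0_norm.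
have h2 : psi (c2 + r2) < M by apply: Hc2 => //; lra.
have h1 : M < psi (c1 - r1) by apply: Hc1 => //; lra.
have x12 : c1 - r1 <= c2 + r2.
  rewrite leNgt; apply/negP => /(sp_psi_decr sp Ix2 Ix1); lra.
have cw : {within `[c1 - r1, c2 + r2], continuous psi}.
  apply: continuous_in_subspaceT => x; rewrite inE/= in_itv/= => xx.
  by apply: cpsi; apply: open_itv_convex Ix1 Ix2 xx.
have [|c] := IVT (v := M) x12 cw.
  by rewrite ge_min le_max (ltW h2) (ltW h1) !orbT.
by rewrite in_itv/= => cx psic; exists c => //; apply: open_itv_convex Ix1 Ix2 cx.
Qed.

(** Surjectivity of [psi] onto the line ensures that [inv_on] never returns its default value. *)
Lemma inv_psiK M : psi (q M) = M.
Proof. by apply: (surjpK (fun=> 0) psi_surj); rewrite inE. Qed.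

Lemma inv_psi_itv M : I (q M).
Proof. by apply: (surjpinv_image_sub (dflt := fun=> 0) psi_surj); exists M. Qed.

Lemma psiK x : I x -> q (psi x) = x.
Proof.
move=> Ix; apply: contrapT => /eqP; rewrite neq_lt => /orP[h|h].
  by have := sp_psi_decr sp (inv_psi_itv _) Ix h; rewrite inv_psiK ltxx.
by have := sp_psi_decr sp Ix (inv_psi_itv _) h; rewrite inv_psiK ltxx.
Qed.

Lemma inv_psi_derive y : is_derive y 1 q (derive1 q y).
Proof. by rewrite derive1E; apply: DeriveDef => //; exact: sp_inv_derivable sp y. Qed.

Lemma inv_psi_lipschitz B : exists2 K, 0 < K &
  forall x y, `|x| <= B -> `|y| <= B -> `|derive1 q x - derive1 q y| <= K * `|x - y|.
Proof.
have [M [Mr HM]] := sp_inv_lipschitz sp (@segment_compact R (- B) B).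
exists (`|M| + 1); first by rewrite ltr_wpDl.
have M1 : M < `|M| + 1 by rewrite (le_lt_trans (ler_norm M))// ltrDl.
move=> x y xB yB; apply: (HM _ M1 (x, y)).
by split; rewrite /= in_itv/= -ler_norml.
Qed.

Lemma derive_inv_psi_continuous : continuous (derive1 q).
Proof.
move=> x; have [K K0 HK] := inv_psi_lipschitz (`|x| + 1).
apply/cvgrPdist_lt => /= e e0; rewrite -nbhs_nearE; apply/nbhs_ballP.
exists (Num.min 1 (e / K)) => /=; first by rewrite lt_min ltr01 divr_gt0.
move=> y; rewrite /ball/= lt_min => /andP[y1 y2].
apply: le_lt_trans (HK _ _ _ _) _; first by rewrite lerDl.
  have := ler_normB x (x - y); rewrite opprB addrC subrK.
  by move/le_trans; apply; rewrite lerD2l ltW.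
by rewrite mulrC -ltr_pdivlMr.
Qed.

(** Differentiating [q (psi x) = x] where [psi] is differentiable gives
    [derive1 q (psi x) * derive1 psi x = 1]; comparison with the friction identity yields the claim
    almost everywhere, and both sides are continuous. *)
Lemma sigma_inv_psi y : sigma (q y) = - lam * derive1 q y.
Proof.
have := @ae_continuous_eq0 a b (fun x => sigma x + lam * derive1 q (psi x)) _ _ (q y)
  (inv_psi_itv y).
rewrite inv_psiK => H; suff : sigma (q y) + lam * derive1 q y = 0 by lra.
apply: H => [x Ix|].
  apply: cvgD; first by apply: (sp_sigma_cont sp); rewrite inE.
  apply: cvgM; first exact: cvg_cst.
  apply: continuous_comp; first exact: cpsi.
  exact: derive_inv_psi_continuous.
have := sp_friction sp; apply: filterS; first exact: (ae_filter_ringOfSetsType lebesgue_measure).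
move=> x Hx Ix.
have [dpsi sE] := Hx Ix.
have D1 : is_derive x 1 psi (derive1 psi x) by rewrite derive1E; exact: DeriveDef.
have D2 := @is_derive1_comp R q psi x _ _ (inv_psi_derive (psi x)) D1.
have D3 : is_derive x 1 (q \o psi) 1.
  have E : {near x, id =1 q \o psi}.
    by apply: filterS (open_itv_nbhs Ix) => z Iz; rewrite /= psiK.
  exact: (near_eq_is_derive E).
have := @derive_val _ _ _ _ _ _ _ D2; rewrite (@derive_val _ _ _ _ _ _ _ D3).
move=> E; have nz : derive1 psi x != 0.
  by apply/eqP => p0; move/eqP: E; rewrite p0 mulr0 oner_eq0.
apply: (mulIf nz); rewrite mul0r mulrDl sE -mulrA.
by rewrite -E; ring.
Qed.

(** Where the friction identity holds, [sigma] is nonzero and [sp_psiE] gives [mu = psi * sigma];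
    continuity carries this over to the zeros of [sigma], where [psi] is not given by a quotient. *)
Lemma mu_inv_psi y : mu (q y) = y * sigma (q y).
Proof.
have := @ae_continuous_eq0 a b (fun x => mu x - psi x * sigma x) _ _ (q y)
  (inv_psi_itv y).
rewrite inv_psiK => H; suff : mu (q y) - y * sigma (q y) = 0 by lra.
apply: H => [x Ix|].
  apply: cvgB; first by apply: (sp_mu_cont sp); rewrite inE.
  apply: cvgM; first exact: cpsi.
  by apply: (sp_sigma_cont sp); rewrite inE.
have := sp_friction sp; apply: filterS; first exact: (ae_filter_ringOfSetsType lebesgue_measure).
move=> x Hx Ix.
have [_ sE] := Hx Ix; have l0 := sp_lam_gt0 sp.
have s0 : sigma x != 0.
  by apply: contraPneq sE => ->; rewrite mul0r; lra.
by rewrite (sp_psiE sp)// divfK// subrr.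
Qed.

Lemma state_space_transform_itv x : I (f x).
Proof. exact: inv_psi_itv. Qed.

Lemma state_space_transform_derive x : is_derive x 1 f (f' x).
Proof.
have D : is_derive x 1 (fun x => - lam * x) (- lam).
  by rewrite -[X in is_derive _ _ _ X]mulr1; exact: is_deriveZ.
rewrite /f' mulrC.
exact: (@is_derive1_comp R q (fun x => - lam * x) x _ _ (inv_psi_derive _) D).
Qed.

Lemma state_space_transform_lipschitz B : exists2 K, 0 < K &
  forall x y, `|x| <= B -> `|y| <= B -> `|f' x - f' y| <= K * `|x - y|.
Proof.
have l0 := sp_lam_gt0 sp.
have [K K0 HK] := inv_psi_lipschitz (lam * B).
exists (lam * K * lam); first by rewrite !mulr_gt0.
move=> x y xB yB; rewrite /f'.
rewrite (_ : _ - _ = - (lam * (derive1 q (- lam * x) - derive1 q (- lam * y)))); last by ring.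
rewrite normrN normrM (gtr0_norm l0) -(mulrA lam) -(mulrA lam) ler_pM2l// -mulrA.
apply: le_trans (HK _ _ _ _) _.
- by rewrite normrM normrN (gtr0_norm l0) ler_pM2l.
- by rewrite normrM normrN (gtr0_norm l0) ler_pM2l.
by rewrite ler_pM2l// -mulrBr normrM normrN (gtr0_norm l0).
Qed.

Lemma state_space_transform_continuous_derive : continuous f'.
Proof.
move=> x; apply: cvgM; first exact: cvg_cst.
apply: (@continuous_comp _ _ _ (fun x => - lam * x)).
  by apply: cvgM; [exact: cvg_cst|exact: cvg_id].
exact: derive_inv_psi_continuous.
Qed.

Lemma sigma_state_space_transform x : sigma (f x) = f' x.
Proof. exact: sigma_inv_psi. Qed.

Lemma mu_state_space_transform x : mu (f x) = - lam * x * f' x.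
Proof. by rewrite mu_inv_psi -sigma_state_space_transform. Qed.

End StateSpaceTransform.


(** * The pathwise Ornstein-Uhlenbeck process and its transform *)

Section Langevin.
Context {R : realType}.
Implicit Types (s t u v x y z r : R) (g h : R -> R).

Lemma continuous_integrable_segment h s t : continuous h ->
  (@lebesgue_measure R).-integrable `[s, t] (EFin \o h).
Proof.
move=> ch; apply: continuous_compact_integrable; first exact: segment_compact.
exact: continuous_subspaceT.
Qed.

(** Integrals from the base point [- n] are primitives only to the right of it. Two of them differ
    by a constant, so normalizing at 0 glues them along the whole line. *)
Lemma continuous_primitive h : continuous h ->
  exists G : R -> R, forall x, is_derive x 1 G (h x).
Proof.
move=> ch.
pose F (n : nat) x := \int[@lebesgue_measure R]_(u in `[(- n%:R)%R, x]) h u.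
have dF n x : - n%:R < x -> is_derive x 1 (F n) (h x).
  move=> nx; have x1 : x < x + 1 by rewrite ltrDl.
  have [? <-] := continuous_FTC1_closed x1 (continuous_integrable_segment _ _ ch) nx (ch x).
  by rewrite derive1E; exact: DeriveDef.
have E m n x y : - m%:R < x -> - n%:R < x -> x <= y -> F m y - F m x = F n y - F n x.
  move=> mx nx xy.
  have dD z : z \in `]x, y[ -> is_derive z 1 (F m - F n) ((fun=> 0) z).
    rewrite in_itv/= => /andP[xz _].
    rewrite -(subrr (h z)); apply: is_deriveB; apply: dF.
      exact: lt_trans mx xz.
    exact: lt_trans nx xz.
  have cD : {within `[x, y], continuous (F m - F n)}.
    apply: continuous_in_subspaceT => z; rewrite inE/= in_itv/= => /andP[xz _].
    apply: differentiable_continuous; apply/derivable1_diffP.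
    apply: derivableB.
      by have [] := dF m z (lt_le_trans mx xz).
    by have [] := dF n z (lt_le_trans nx xz).
  have [c _ H] := MVT_segment xy dD cD.
  have {H} : F m y - F n y - (F m x - F n x) = 0 := etrans H (mul0r _).
  by lra.
(* [- N x] lies strictly below both [x] and 0, so [F (N x)] may be evaluated and differentiated at
   either point. *)
pose N x := (Num.truncn `|x|).+1.
have NP x : - (N x)%:R < x.
  rewrite ltrNl; apply: le_lt_trans (truncnS_gt _).
  by rewrite -normrN ler_norm.
pose G x := F (N x) x - F (N x) 0.
have N0 x : - (N x)%:R < 0 :> R by rewrite oppr_lt0 ltr0n.
have GE n x : - n.+1%:R < x -> G x = F n.+1 x - F n.+1 0.
  move=> nx; rewrite /G.
  have n0 : - n.+1%:R < 0 :> R by rewrite oppr_lt0 ltr0n.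
  have [x0|/ltW x0] := leP x 0.
    by have := E (N x) n.+1 _ _ (NP x) nx x0; lra.
  by have := E (N x) n.+1 _ _ (N0 x) n0 x0; lra.
exists G => x.
have nx : - (N x)%:R < x := NP x.
apply: (@near_eq_is_derive _ _ _ (fun y => F (N x) y - F (N x) 0)).
  near=> y; rewrite (GE (Num.truncn `|x|))//.
  by near: y; exact: lt_nbhsr.
rewrite -[h x]subr0; exact: is_deriveB (dF _ _ nx) (is_derive_cst _ _ _).
Unshelve. all: end_near. Qed.

Lemma Rintegral_primitive h G s t : continuous h ->
  (forall x, is_derive x 1 G (h x)) -> s <= t ->
  \int[@lebesgue_measure R]_(u in `[s, t]) h u = G t - G s.
Proof.
move=> ch dG; rewrite le_eqVlt => /predU1P[->|st].
  by rewrite set_itv1 Rintegral_set1 subrr.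
have cG := is_derive_continuous dG.
rewrite /Rintegral (continuous_FTC2 (F := G) st)//.
- exact: continuous_subspaceT.
- split; first by move=> x _; have [] := dG x.
  + exact: cvg_at_right_filter (cG s).
  + exact: cvg_at_left_filter (cG t).
- by move=> x _; rewrite derive1E; have [_] := dG x.
Qed.

Lemma is_derive_lipschitz (f f' : R -> R) (K B u v : R) :
  (forall x, is_derive x 1 f (f' x)) -> (forall x, `|x| <= B -> `|f' x| <= K) ->
  `|u| <= B -> `|v| <= B -> `|f v - f u| <= K * `|v - u|.
Proof.
move=> df fK; wlog uv : u v / u <= v => [H|] uB vB.
  have [/H|/ltW/H] := leP u v; first exact.
  by move=> /(_ vB uB); rewrite distrC (distrC u).
rewrite (ger0_norm (_ : 0 <= v - u)) ?subr_ge0//.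
apply: (is_derive_incr_le df) => // x /andP[ux xv]; apply: fK.
by move: uB vB; rewrite !ler_norml => /andP[? ?] /andP[? ?]; lra.
Qed.

Lemma powRD_le (p x y : R) : 0 <= p -> 0 <= x -> 0 <= y ->
  (x + y) `^ p <= 2 `^ p * (x `^ p + y `^ p).
Proof.
move=> p0 x0 y0.
have K z : 0 <= z -> x + y <= 2 * z -> (x + y) `^ p <= 2 `^ p * z `^ p.
  by move=> z0 h; rewrite -powRM//; apply: ge0_ler_powR; rewrite ?nnegrE ?mulr_ge0 ?addr_ge0.
have [xy|yx] := leP x y.
  apply: le_trans (K y y0 _) _; first by lra.
  by rewrite ler_wpM2l ?powR_ge0// lerDr powR_ge0.
apply: le_trans (K x x0 _) _; first by lra.
by rewrite ler_wpM2l ?powR_ge0// lerDl powR_ge0.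
Qed.

Section operator.
Variables (lam p D : R) (g : R -> R).
Hypothesis lam0 : 0 < lam.
Hypothesis p0 : p != 0.
Hypothesis cg : continuous g.
Hypothesis pv : forall s t, s <= t -> (p_variation p g s t < +oo)%E.
Hypothesis gD : forall t, t <= 0 -> `|g t| <= D * expR (- (lam * t / 2)).

(** The Riemann integrand left after integrating exp(lam s) by parts against dg. *)
Let h s := lam * expR (lam * s) * g s.

Lemma is_derive_expRZ (k s : R) : is_derive s 1 (fun s => expR (k * s)) (k * expR (k * s)).
Proof.
have D1 : is_derive s 1 (fun s => k * s) k.
  by rewrite -[X in is_derive _ _ _ X]mulr1; exact: is_deriveZ.
rewrite mulrC; exact: (@is_derive1_comp R expR (fun s => k * s) s _ _ (is_derive_expR _) D1).
Qed.

Lemma expRZ_cvgNy (k : R) : 0 < k -> expR (k * r) @[r --> -oo] --> 0.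
Proof.
move=> k0; apply/cvgNy_compNP => /=.
have H : k * x @[x --> +oo] --> +oo by apply: gt0_cvgMry => //; exact: cvg_id.
have := cvg_comp _ _ H (@cvgr_expR R).
by rewrite (_ : _ \o _ = fun x => expR (k * - x))//; apply/funext => x /=; rewrite mulrN.
Qed.

Let ch : continuous h.
Proof.
move=> s; apply: cvgM; last exact: cg.
apply: cvgM; first exact: cvg_cst.
exact: is_derive_continuous (is_derive_expRZ lam) s.
Qed.

(** On the negative half-line the derivative of [E] dominates [|h|], so [E + G] and [E - G] are
    nondecreasing there; the increments of [G] are bounded by those of [E], which tends to 0 at -oo,
    and [G] is Cauchy. *)
Lemma OU_primitive_cvg G : (forall s, is_derive s 1 G (h s)) -> cvg (G r @[r --> -oo]).
Proof.
move=> dG; pose E s := 2 * D * expR (lam / 2 * s).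
have D0 : 0 <= D.
  by have := le_trans (normr_ge0 _) (gD (lexx 0)); rewrite mulr0 mul0r oppr0 expR0 mulr1.
have dE s : is_derive s 1 E (lam * D * expR (lam / 2 * s)).
  rewrite (_ : lam * D * _ = 2 * D * (lam / 2 * expR (lam / 2 * s))); last by field.
  exact: is_deriveZ (is_derive_expRZ _ _).
have hE s : s <= 0 -> `|h s| <= lam * D * expR (lam / 2 * s).
  move=> s0; rewrite /h normrM ger0_norm ?mulr_ge0 ?expR_ge0 ?(ltW lam0)//.
  rewrite -[leLHS]mulrA -[leRHS]mulrA ler_pM2l//.
  apply: le_trans (ler_wpM2l (expR_ge0 _) (gD s0)) _.
  rewrite mulrCA -expRD le_eqVlt; apply/orP; left; apply/eqP; by congr (_ * expR _); field.
have GE u v : u <= v -> v <= 0 -> `|G v - G u| <= E v - E u.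
  move=> uv v0.
  have [c1] := MVT_segment uv (fun x _ => is_deriveB (dE x) (dG x))
    (@continuous_subspaceT _ _ _ _ (is_derive_continuous (fun x => is_deriveB (dE x) (dG x)))).
  have [c2] := MVT_segment uv (fun x _ => is_deriveD (dE x) (dG x))
    (@continuous_subspaceT _ _ _ _ (is_derive_continuous (fun x => is_deriveD (dE x) (dG x)))).
  rewrite !in_itv/= => /andP[_ c2v] H2 /andP[_ c1v] H1.
  have {}H1 : E v - G v - (E u - G u) = (lam * D * expR (lam / 2 * c1) - h c1) * (v - u) := H1.
  have {}H2 : E v + G v - (E u + G u) = (lam * D * expR (lam / 2 * c2) + h c2) * (v - u) := H2.
  have /ler_normlP[h1 h2] := hE c1 (le_trans c1v v0).
  have /ler_normlP[h3 h4] := hE c2 (le_trans c2v v0).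
  have k1 : 0 <= (lam * D * expR (lam / 2 * c1) - h c1) * (v - u) by rewrite mulr_ge0 ?subr_ge0.
  have k2 : 0 <= (lam * D * expR (lam / 2 * c2) + h c2) * (v - u).
    by apply: mulr_ge0; [lra|rewrite subr_ge0].
  by rewrite ler_norml; apply/andP; split; lra.
have E0 : E r @[r --> -oo] --> 0.
  rewrite -(mulr0 (2 * D)); apply: cvgM; first exact: cvg_cst.
  by apply: expRZ_cvgNy; rewrite divr_gt0.
apply: cauchy_cvg; apply: cauchy_exP => e e0.
have : \forall r \near -oo, E r < e /\ r <= 0.
  near=> r; split; near: r; last by apply: nbhs_ninfty_le; rewrite num_real.
  have /cvgrPdist_lt/(_ _ e0) := E0; apply: filterS => r.
  by rewrite sub0r normrN; apply: le_lt_trans; exact: ler_norm.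
move=> /filter_ex[v [Ev v0]]; exists (G v).
suff : \forall r \near -oo, `|G v - G r| < e by [].
near=> r; apply: le_lt_trans (GE r v _ v0) _.
  by near: r; apply: nbhs_ninfty_le; rewrite num_real.
apply: le_lt_trans Ev; rewrite gerBl mulr_ge0 ?expR_ge0// mulr_ge0//.
Unshelve. all: end_near. Qed.

(** Integration by parts on [[r, t]] leaves a boundary term at [r] of order exp(lam r / 2). Here [l]
    is the limit of [G] at -oo, so [G - l] is the primitive of [h] vanishing there. *)
Lemma OU_integralE : exists G l, (forall s, is_derive s 1 G (h s)) /\
  forall t, OU_integral lam g t = g t - expR (- (lam * t)) * (G t - l).
Proof.
have [G dG] := continuous_primitive ch; exists G, (lim (G r @[r --> -oo])); split => // t.
apply: cvg_lim => //.
pose phi s := expR (- (lam * (t - s))).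
have phiE s : phi s = expR (- (lam * t)) * expR (lam * s).
  by rewrite -expRD /phi; congr expR; ring.
have dphi s : is_derive s 1 phi (lam * phi s).
  rewrite (_ : phi = fun s => expR (- (lam * t)) * expR (lam * s)); last exact/funext.
  by rewrite mulrCA; exact: is_deriveZ (is_derive_expRZ _ _).
have cphi : continuous (fun s => lam * phi s).
  by move=> s; apply: cvgM; [exact: cvg_cst|exact: (is_derive_continuous dphi)].
pose B s := expR (- (lam * t)) * G s.
have dB s : is_derive s 1 B (lam * phi s * g s).
  rewrite phiE (_ : _ * _ * _ = expR (- (lam * t)) * h s); last by rewrite /h; ring.
  exact: is_deriveZ.
have RE r : r <= t -> RSint phi g r t = g t - phi r * g r - expR (- (lam * t)) * (G t - G r).
  move=> rt; have := is_RSint_by_parts rt p0 (pv rt) cg cphi dphi dB.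
  have -> : phi t = 1 by rewrite /phi subrr mulr0 oppr0 expR0.
  rewrite mul1r => /(RSintE rt) ->.
  by rewrite /B; ring.
have K : (g t - phi r * g r - expR (- (lam * t)) * (G t - G r)) @[r --> -oo] -->
   g t - 0 - expR (- (lam * t)) * (G t - lim (G r @[r --> -oo])).
  apply: cvgB; last first.
    apply: cvgM; first exact: cvg_cst.
    by apply: cvgB; [exact: cvg_cst|exact: OU_primitive_cvg].
  apply: cvgB; first exact: cvg_cst.
  apply/norm_cvg0P.
  have Z : expR (- (lam * t)) * D * expR (lam / 2 * r) @[r --> -oo] --> 0.
    rewrite -(mulr0 (expR (- (lam * t)) * D)); apply: cvgM; first exact: cvg_cst.
    by apply: expRZ_cvgNy; rewrite divr_gt0.
  apply: (squeeze_cvgr _ (cvg_cst 0) Z); near=> r.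
  rewrite normr_ge0/= normrM ger0_norm ?expR_ge0// phiE -!mulrA ler_pM2l ?expR_gt0//.
  have r0 : r <= 0 by near: r; apply: nbhs_ninfty_le; rewrite num_real.
  apply: le_trans (ler_wpM2l (expR_ge0 _) (gD r0)) _.
  rewrite mulrCA -expRD le_eqVlt; apply/orP; left; apply/eqP; by congr (_ * expR _); field.
rewrite subr0 in K; apply: cvg_trans K; apply: near_eq_cvg.
near=> r; rewrite RE//; near: r; apply: nbhs_ninfty_le; rewrite num_real//.
Unshelve. all: end_near. Qed.

Lemma OU_operatorE (tau z : R) : exists A : R -> R,
  let Y t := g t + A t in
  OU_operator lam g tau z = Y /\ forall t, is_derive t 1 A (- lam * Y t).
Proof.
have [G [l [dG OE]]] := OU_integralE.
(* Pulling exp(- lam t) out of every term except [g t] leaves [c - G t], with all the dependence on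
   [tau] and [z] in the constant [c]. *)
pose c := l - expR (lam * tau) * OU_integral lam g tau + expR (lam * tau) * z.
exists (fun t => expR (- lam * t) * (c - G t)); split.
  apply/funext => t; rewrite /OU_operator (OE t).
  rewrite (_ : - (lam * (t - tau)) = - lam * t + lam * tau); last by ring.
  by rewrite expRD /c mulNr; ring.
move=> t /=.
rewrite (_ : - lam * _ = expR (- lam * t) *: (0 - h t) + (c - G t) *: (- lam * expR (- lam * t))).
  apply: is_deriveM; first exact: is_derive_expRZ.
rewrite /GRing.scale/= /h.
have -> : expR (- lam * t) * (0 - lam * expR (lam * t) * g t) = - lam * (expR (- lam * t) * expR (lam * t)) * g t by ring.
rewrite -expRD (_ : - lam * t + lam * t = 0); last by ring.
by rewrite expR0; ring.
Qed.

End operator.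

Section solution.
Variables (a b : \bar R) (mu sigma psi : R -> R) (lam p D : R) (g : R -> R).
Hypothesis sp : strongly_proper a b mu sigma psi lam.
Hypothesis p12 : 1 <= p < 2.
Hypothesis cg : continuous g.
Hypothesis pv : forall s t, s <= t -> (p_variation p g s t < +oo)%E.
Hypothesis gD : forall t, t <= 0 -> `|g t| <= D * expR (- (lam * t / 2)).

Let f := state_space_transform a b psi lam.

Lemma OU_solution (tau z : R) : let X t := f (OU_operator lam g tau z t) in
  [/\ Wcon p X, forall t, open_itv a b (X t) &
    forall s t, s <= t -> RS_integrable (fun u => sigma (X u)) g s t /\
      X t - X s = \int[lebesgue_measure]_(u in `[s, t]) mu (X u) +
         RSint (fun u => sigma (X u)) g s t].
Proof.
move=> X; have [p1 p2] := andP p12; have p0 : 0 < p by lra.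
have [A [YE dA]] := OU_operatorE (sp_lam_gt0 sp) (lt0r_neq0 p0) cg pv gD tau z.
have XE : X = f \o (fun t => g t + A t) by rewrite /X YE.
clearbody X; subst X.
pose Y t := g t + A t; rewrite -/(Y) in dA *.
have cA := is_derive_continuous dA.
have cY : continuous Y by move=> t; apply: cvgD; [exact: cg|exact: cA].
pose f' := fun x => - lam * derive1 (inv_on (open_itv a b) psi) (- lam * x).
have df : forall x, is_derive x 1 f (f' x) := state_space_transform_derive sp.
have cf' : continuous f' := state_space_transform_continuous_derive sp.
have cA' : continuous (fun t => - lam * Y t).
  by move=> t; apply: cvgM; [exact: cvg_cst|exact: cY].
have muE : mu \o (f \o Y) = fun u => f' (Y u) * (- lam * Y u).
  by apply/funext => u /=; rewrite (mu_state_space_transform sp) mulrC.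
have sigmaE : sigma \o (f \o Y) = f' \o Y.
  by apply/funext => u /=; exact: (sigma_state_space_transform sp).
have cmu : continuous (mu \o (f \o Y)).
  rewrite muE => u; apply: cvgM; last exact: cA'.
  by apply: continuous_comp; [exact: cY|exact: cf'].
(* Because [A' = - lam * Y], the drift [mu (f (Y u))] equals [f' (Y u) * A' u]: this [M] is both the
   primitive of the drift and the correction term of [is_RSint_chain], and it cancels in the end. *)
have [M dM] := continuous_primitive cmu.
split.
- split.
    move=> t; apply: continuous_comp; first exact: cY.
    exact: is_derive_continuous df _.
  move=> s t st.
  have [K1 K10 K1P] := segment_bounded s t cA'.
  have [B B0 BP] := segment_bounded s t cY.
  have [K2 K20 K2P] := segment_bounded (- B) B cf'.
  (* [K2] is a Lipschitz constant of [f] on the range of [Y] and [K1] bounds [A']. The factor 2^p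
     splits the power of a sum, and the power [p] of a length is at most the length times the power
     [p - 1] of [t - s], by [1 <= p]. *)
  apply: (p_variation_lty (g := g) (c := K2 `^ p * 2 `^ p * (1 + K1 `^ p * (t - s) `^ (p - 1)))) => //.
  - exact: lt0r_neq0.
  - by rewrite !mulr_ge0 ?powR_ge0// addr_ge0// mulr_ge0// powR_ge0.
  - move=> u v su uv vt.
    have [ut sv] : u <= t /\ s <= v by split; [apply: le_trans vt|apply: le_trans su _]; exact: ltW.
    have h1 : `|f (Y v) - f (Y u)| <= K2 * `|Y v - Y u|.
      apply: (is_derive_lipschitz (B := B) df).
      + by move=> x xB; apply: K2P; rewrite -ler_norml.
      + by apply: BP; rewrite su.
      + by apply: BP; rewrite sv.
    have h2 : `|Y v - Y u| <= `|g v - g u| + K1 * (v - u).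
      rewrite (_ : Y v - Y u = (g v - g u) + (A v - A u)); last by rewrite /Y; ring.
      apply: le_trans (ler_normD _ _) _; rewrite lerD2l.
      apply: (is_derive_incr_le dA (ltW uv)) => y /andP[uy yv].
      by apply: K1P; rewrite (le_trans su)//= (le_trans yv).
    have vu0 : 0 <= v - u by rewrite subr_ge0 ltW.
    have h3 : 0 <= K1 * (v - u) by rewrite mulr_ge0// ltW.
    have h4 : (K1 * (v - u)) `^ p <= K1 `^ p * (t - s) `^ (p - 1) * (v - u).
      rewrite powRM// ?(ltW K10)// -mulrA ler_wpM2l ?powR_ge0//.
      rewrite -mulr_powRB1// mulrC ler_wpM2r//.
      by apply: ge0_ler_powR; rewrite ?nnegrE ?subr_ge0//; lra.
    apply: (@le_trans _ _ ((K2 * (`|g v - g u| + K1 * (v - u))) `^ p)).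
      apply: ge0_ler_powR; rewrite ?nnegrE ?mulr_ge0 ?addr_ge0 ?(ltW p0) ?(ltW K20)//.
      by apply: le_trans h1 _; rewrite ler_pM2l.
    rewrite powRM ?(ltW K20) ?addr_ge0// -mulrA -[in leRHS]mulrA ler_wpM2l ?powR_ge0//.
    apply: le_trans (powRD_le (ltW p0) (normr_ge0 _) h3) _.
    rewrite ler_wpM2l ?powR_ge0//.
    move: h4; set w := v - u in vu0 *.
    have := powR_ge0 K1 p; have := powR_ge0 (t - s) (p - 1); have := powR_ge0 `|g v - g u| p.
    move: (K1 `^ p) ((t - s) `^ (p - 1)) (`|_| `^ p) => c1 c2 c3 k3 k2 k1 k4.
    have := mulr_ge0 (mulr_ge0 k1 k2) k3; have := mulr_ge0 (mulr_ge0 k1 k2) vu0.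
    by lra.
  - exact: pv.
- by move=> t; exact: (state_space_transform_itv sp).
- move=> s t st.
  have H : is_RSint (f' \o Y) g s t (f (Y t) - f (Y s) - (M t - M s)).
    apply: (is_RSint_chain (p := p) (A' := fun t => - lam * Y t)) => //.
    + by rewrite p0.
    + exact: pv.
    + exact: (state_space_transform_lipschitz sp).
    + by move=> x; have := dM x; rewrite muE.
  rewrite -[fun u => sigma _]/(sigma \o (f \o Y)) sigmaE; split; first by eexists; exact: H.
  rewrite (RSintE st H) (Rintegral_primitive cmu dM st)/=; ring.
Qed.

End solution.
End Langevin.


(** * Deterministic chaining on dyadic points *)

Section Chaining.
Context {R : realType}.
Implicit Types (g : R -> R) (m t B rho : R) (n k j : nat).

Definition dyadic_incr g m k j : R :=
  g (m + j.+1%:R / 2 ^+ k) - g (m + j%:R / 2 ^+ k).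

(** An even point of level k + 1 already occurs at level k, and an odd one is a single step away
    from its left neighbour, so each level costs one increment. Continuity passes from dyadic points
    to all of the interval. *)
Lemma dyadic_chaining g m B rho t : continuous g -> 0 <= B -> 0 <= rho < 1 ->
  (forall k j, (j < 2 ^ k)%N -> `|dyadic_incr g m k j| <= B * rho ^+ k) ->
  m <= t <= m + 1 -> `|g t - g m| <= B / (1 - rho).
Proof.
move=> cg B0 /andP[r0 r1] H /andP[mt tm].
have r10 : 0 < 1 - rho by rewrite subr_gt0.
(* The right-hand side is B times the geometric sum of rho^i over i <= k. *)
have S k j : (j <= 2 ^ k)%N ->
    `|g (m + j%:R / 2 ^+ k) - g m| <= B * (1 - rho ^+ k.+1) / (1 - rho).
  elim: k j => [|k IH] j; rewrite ?expn0.
    rewrite leq_eqVlt ltnS leqn0 => /orP[/eqP->|/eqP->].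
      have := H 0%N 0%N isT; rewrite /dyadic_incr mul0r addr0.
      by rewrite expr1 mulfK ?gt_eqF// mulr1.
    by rewrite mul0r addr0 subrr normr0 expr1 mulfK ?gt_eqF.
  have half i : m + i.*2%:R / 2 ^+ k.+1 = m + i%:R / 2 ^+ k.
    by rewrite -mul2n natrM exprS; field; rewrite expf_neq0.
  have IH' i : (i <= 2 ^ k)%N ->
      `|g (m + i.*2%:R / 2 ^+ k.+1) - g m| <= B * (1 - rho ^+ k.+2) / (1 - rho).
    move=> ik; rewrite half; apply: le_trans (IH _ ik) _.
    rewrite ler_pM2r ?invr_gt0// ler_wpM2l// lerD2l lerN2 [leLHS]exprS.
    by rewrite ler_piMl ?exprn_ge0// ltW.
  rewrite -(odd_double_half j); case: (odd j) => /=; last first.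
    rewrite add0n => jk; apply: IH'.
    by rewrite -(leq_pmul2l (ltn0Sn 1)) -expnS mul2n.
  rewrite add1n => jk; set i := j./2 in jk *.
  have ik : (i <= 2 ^ k)%N.
    by rewrite -(leq_pmul2l (ltn0Sn 1)) -expnS mul2n ltnW.
  rewrite (_ : _ - _ = dyadic_incr g m k.+1 i.*2 + (g (m + i.*2%:R / 2 ^+ k.+1) - g m)).
    apply: le_trans (ler_normD _ _) _; rewrite half.
    apply: le_trans (lerD (H _ _ jk) (IH _ ik)) _.
    rewrite le_eqVlt; apply/orP; left; apply/eqP.
    by rewrite [in RHS]exprS; field; rewrite gt_eqF.
  by rewrite /dyadic_incr; ring.
have {}S k j : (j <= 2 ^ k)%N -> `|g (m + j%:R / 2 ^+ k) - g m| <= B / (1 - rho).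
  move=> /S/le_trans; apply; rewrite ler_pM2r ?invr_gt0// ler_piMr//.
  by rewrite lerBlDr lerDl exprn_ge0.
apply/ler_addgt0Pr => e e0.
have /cvgrPdist_le/(_ _ e0) := cg t; rewrite -nbhs_nearE => /nbhs_ballP[del /= d0 dP].
have [k kP] : exists k, (2 ^+ k)^-1 < del.
  have : 2^-1 ^+ k @[k --> \oo] --> (0 : R).
    by apply: cvg_expr; rewrite ger0_norm; lra.
  move=> /cvgrPdist_lt/(_ _ d0)[N _ /(_ N (leqnn N))]; rewrite sub0r normrN.
  by rewrite ger0_norm ?exprn_ge0// exprVn => NP; exists N.
have p0 : 0 < 2 ^+ k :> R by rewrite exprn_gt0.
set j := Num.truncn ((t - m) * 2 ^+ k).
have tm0 : 0 <= (t - m) * 2 ^+ k by rewrite mulr_ge0 ?subr_ge0// ltW.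
have [j1 j2] : j%:R <= (t - m) * 2 ^+ k /\ (t - m) * 2 ^+ k < j.+1%:R.
  by rewrite truncnS_gt; split => //; rewrite truncn_le.
have jk : (j <= 2 ^ k)%N.
  rewrite -(ler_nat R) natrX; apply: le_trans j1 _.
  by rewrite ler_piMl//; lra.
have h : `|t - (m + j%:R / 2 ^+ k)| < del.
  rewrite ger0_norm; last by rewrite opprD addrA subr_ge0 ler_pdivrMr.
  apply: lt_trans kP; rewrite -(ltr_pM2r p0) mulVf ?gt_eqF// mulrBl mulrDl divfK ?gt_eqF//.
  by move: j2; rewrite -natr1; lra.
rewrite (_ : g t - g m = (g t - g (m + j%:R / 2 ^+ k)) + (g (m + j%:R / 2 ^+ k) - g m)); last by ring.
apply: le_trans (ler_normD _ _) _; rewrite addrC; apply: lerD; first exact: S.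
exact: dP.
Qed.

Lemma dyadic_growth g lam B rho : continuous g -> 0 < lam -> 0 <= B -> 0 <= rho < 1 ->
  (forall n k j, (j < 2 ^ k)%N ->
    `|dyadic_incr g (- n.+1%:R) k j| <= B * expR (lam / 2) ^+ n * rho ^+ k) ->
  exists D, forall t, t <= 0 -> `|g t| <= D * expR (- (lam * t / 2)).
Proof.
move=> cg l0 B0 r01 H; have /andP[r0 r1] := r01.
set th := expR (lam / 2) in H *; set B' := B / (1 - rho).
have th1 : 1 < th by rewrite expR_gt1 divr_gt0.
have th0 : 0 < th by exact: lt_trans th1.
have B'0 : 0 <= B' by rewrite divr_ge0// subr_ge0 ltW.
have K n t : - n.+1%:R <= t <= - n%:R -> `|g t - g (- n.+1%:R)| <= B' * th ^+ n.
  move=> tn; rewrite /B' mulrAC; apply: dyadic_chaining => //.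
  - by rewrite mulr_ge0// exprn_ge0// ltW.
  - by move=> k j; exact: H.
  - by move: tn; rewrite -natr1; lra.
(* The first entry starts the induction at 0; the second makes [D * th ^ n + B' * th ^ n] at most
   [D * th ^ (n + 1)], so the oscillations of successive unit intervals are absorbed. *)
set D := Num.max `|g 0| (B' / (th - 1)).
have D0 : 0 <= D by rewrite le_max normr_ge0.
have DB : B' <= D * (th - 1).
  by rewrite -ler_pdivrMr ?subr_gt0// le_max lexx orbT.
have gn n : `|g (- n%:R)| <= D * th ^+ n.
  elim: n => [|n IH]; first by rewrite oppr0 expr0 mulr1 le_max lexx.
  have := K n (- n%:R); rewrite lexx andbT lerN2 ler_nat leqnSn => /(_ isT) h.
  rewrite (_ : g (- n.+1%:R) = g (- n%:R) - (g (- n%:R) - g (- n.+1%:R))); last by ring.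
  apply: le_trans (ler_normB _ _) _; apply: le_trans (lerD IH h) _.
  rewrite -mulrDl exprS mulrA ler_wpM2r ?exprn_ge0 ?(ltW th0)//; lra.
exists (D * th + B') => t t0.
set n := Num.truncn (- t).
have nt0 : 0 <= - t by rewrite oppr_ge0.
have [n1 n2] : n%:R <= - t /\ - t < n.+1%:R.
  by rewrite truncnS_gt; split => //; rewrite truncn_le.
have h : `|g t - g (- n.+1%:R)| <= B' * th ^+ n by apply: K; lra.
rewrite (_ : g t = g (- n.+1%:R) + (g t - g (- n.+1%:R))); last by ring.
apply: le_trans (ler_normD _ _) _; apply: le_trans (lerD (gn _) h) _.
rewrite exprS mulrA -mulrDl ler_wpM2l//; first by rewrite addr_ge0// mulr_ge0// ltW.
rewrite /th -expRM_natr ler_expR (_ : - (lam * t / 2) = lam / 2 * - t); last by ring.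
by rewrite ler_pM2l// divr_gt0.
Qed.

End Chaining.


(** * Square integrals over a general measure *)

Section SquareIntegrals.
Context {disp : measure_display} {T : measurableType disp} {R : realType}.
Variable mu : {measure set T -> \bar R}.
Implicit Types (X Y Z W f g : T -> R) (u v c : R).

(** Extended-valued, so that it can be compared before finiteness is known; the measure is general
    because both sides of the isometry, under [P] and under Lebesgue measure, are of this form. *)
Definition sqint X : \bar R := (\int[mu]_w (X w ^+ 2)%:E)%E.

Lemma measurable_sqr X : measurable_fun setT X ->
  measurable_fun setT (fun w => (X w ^+ 2)%:E).
Proof. by move=> mX; apply/measurable_EFinP; exact: measurable_funX. Qed.

Lemma sqint_ge0 X : (0 <= sqint X)%E.
Proof. by apply: integral_ge0 => w _; rewrite lee_fin sqr_ge0. Qed.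

Lemma eq_sqint X Y : X =1 Y -> sqint X = sqint Y.
Proof. by move=> XY; apply: eq_integral => w _; rewrite XY. Qed.

Lemma sqintN X : sqint (fun w => - X w) = sqint X.
Proof. by apply: eq_integral => w _; rewrite sqrrN. Qed.

Lemma sqintC X Y : sqint (fun w => X w - Y w) = sqint (fun w => Y w - X w).
Proof. by rewrite -sqintN; apply: eq_sqint => w; rewrite opprB. Qed.

Lemma sqintZ c X : measurable_fun setT X ->
  sqint (fun w => c * X w) = ((c ^+ 2)%:E * sqint X)%E.
Proof.
move=> mX; rewrite /sqint -ge0_integralZl_EFin ?sqr_ge0//.
- by apply: eq_integral => w _; rewrite exprMn EFinM.
- by move=> w _; rewrite lee_fin sqr_ge0.
- exact: measurable_sqr.
Qed.

Lemma ae_eq_sqint X Y : measurable_fun setT X -> measurable_fun setT Y ->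
  {ae mu, forall w, X w = Y w} -> sqint X = sqint Y.
Proof.
move=> mX mY XY; apply: ae_eq_integral => //; try exact: measurable_sqr.
by move: XY; apply: filterS => w -> _.
Qed.

Lemma sqintD_le X Y : measurable_fun setT X -> measurable_fun setT Y ->
  (sqint (fun w => X w + Y w)%R <= 2%:E * (sqint X + sqint Y))%E.
Proof.
move=> mX mY; have sq0 (Z : T -> R) (w : T) : setT w -> (0 <= (Z w ^+ 2)%:E)%E.
  by move=> _; rewrite lee_fin sqr_ge0.
rewrite /sqint -ge0_integralD//; try by [exact: measurable_sqr | exact: sq0].
rewrite -ge0_integralZl_EFin//; last 2 first.
- by move=> w _; rewrite adde_ge0// sq0.
- by apply: emeasurable_funD; exact: measurable_sqr.
apply: ge0_le_integral => //.
- by move=> w _; exact: (sq0 (X \+ Y)).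
- by apply: measurable_sqr; exact: measurable_funD.
- by apply: measurable_funeM; apply: emeasurable_funD; exact: measurable_sqr.
- move=> w _; rewrite -EFinD -EFinM lee_fin.
  have := sqr_ge0 (X w - Y w); rewrite !expr2; lra.
Qed.

(** Two uses of (a + b)^2 <= 2 a^2 + 2 b^2 on X - Y = (Z - W) + ((X - Z) + (W - Y)). The factor 2 is
    harmless, since only the order of the moments in the time step matters. *)
Lemma sqintB_approx_le X Y Z W (e : R) : measurable_fun setT X -> measurable_fun setT Y ->
  measurable_fun setT Z -> measurable_fun setT W ->
  (sqint (fun w => Z w - X w)%R <= e%:E)%E -> (sqint (fun w => W w - Y w)%R <= e%:E)%E ->
  (sqint (fun w => X w - Y w)%R <= 2%:E * sqint (fun w => Z w - W w)%R + (8 * e)%:E)%E.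
Proof.
move=> mX mY mZ mW ZX WY.
have mZW : measurable_fun setT (fun w => Z w - W w) by exact: measurable_funB.
have mZX : measurable_fun setT (fun w => X w - Z w) by exact: measurable_funB.
have mWY : measurable_fun setT (fun w => W w - Y w) by exact: measurable_funB.
rewrite (@eq_sqint _ (fun w => (Z w - W w) + ((X w - Z w) + (W w - Y w)))); last first.
  by move=> w; ring.
apply: le_trans (sqintD_le mZW (measurable_funD mZX mWY)) _.
have e0 : 0 <= e by rewrite -lee_fin; apply: le_trans ZX; exact: sqint_ge0.
apply: (@le_trans _ _ (2%:E * (sqint (fun w => Z w - W w)%R + 2%:E * (e%:E + e%:E)))%E).
  apply: lee_wpmul2l => //; apply: leeD => //.
  apply: le_trans (sqintD_le mZX mWY) _.
  by apply: lee_wpmul2l => //; apply: leeD => //; rewrite sqintC.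
rewrite -EFinD -EFinM ge0_muleDr ?sqint_ge0// ?lee_fin; last by lra.
by rewrite -EFinM leeD2l// lee_fin; lra.
Qed.

Lemma sqintD_lty X Y : measurable_fun setT X -> measurable_fun setT Y ->
  (sqint X < +oo)%E -> (sqint Y < +oo)%E -> (sqint (fun w => X w + Y w)%R < +oo)%E.
Proof.
move=> mX mY fX fY; apply: le_lt_trans (sqintD_le mX mY) _.
by rewrite lte_mul_pinfty// lte_add_pinfty.
Qed.

(** Integrability travels with the value, which keeps signed linear combinations legitimate in the
    extended reals. *)
Definition has_integral f v :=
  mu.-integrable setT (EFin \o f) /\ (\int[mu]_w (f w)%:E = v%:E)%E.

Lemma has_integralD f g u v : has_integral f u -> has_integral g v ->
  has_integral (fun w => f w + g w) (u + v).
Proof.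
move=> [i1 e1] [i2 e2]; split.
  by rewrite (_ : _ \o _ = (EFin \o f) \+ (EFin \o g))%E//; exact: integrableD.
under eq_integral do rewrite EFinD.
by rewrite integralD// e1 e2.
Qed.

Lemma has_integralZ c f v : has_integral f v ->
  has_integral (fun w => c * f w) (c * v).
Proof.
move=> [i1 e1]; split.
  by rewrite (_ : _ \o _ = fun w => c%:E * (EFin \o f) w)%E//; exact: integrableZl.
under eq_integral do rewrite EFinM.
by rewrite integralZl// e1.
Qed.

Lemma has_integral_sum (I : Type) (s : seq I) (f : I -> T -> R) (v : I -> R) :
  (forall i, has_integral (f i) (v i)) ->
  has_integral (fun w => \sum_(i <- s) f i w) (\sum_(i <- s) v i).
Proof.
move=> H; elim: s => [|i s IH].
  rewrite big_nil (_ : (fun w => _) = fun=> 0); last by apply/funext => w; rewrite big_nil.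
  by split; [exact: integrable0|rewrite integral0].
rewrite big_cons (_ : (fun w => _) = fun w => f i w + \sum_(i <- s) f i w).
  exact: has_integralD.
by apply/funext => w; rewrite big_cons.
Qed.

Lemma has_integral_sqr X v : measurable_fun setT X -> sqint X = v%:E ->
  has_integral (fun w => X w ^+ 2) v.
Proof.
move=> mX Xv; split => //; apply/integrableP; split; first exact: measurable_sqr.
under eq_integral do rewrite /= ger0_norm ?sqr_ge0//.
by rewrite -/(sqint X) Xv ltry.
Qed.

(* The second moment of a linear combination of increments is the same quadratic form for every
   process whose increments have variance K |t - s|, by polarization. *)
Definition increment_form (s : seq (R * (R * R))) : R :=
  \sum_(e <- s) \sum_(e' <- s) e.1 * e'.1 / 2 *
    (`|e'.2.1 - e.2.2| + `|e'.2.2 - e.2.1| - `|e'.2.2 - e.2.2| - `|e'.2.1 - e.2.1|).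

Lemma sqint_increments (X : R -> T -> R) K (s : seq (R * (R * R))) :
  (forall t, measurable_fun setT (X t)) ->
  (forall t t', sqint (fun w => X t' w - X t w) = (K * `|t' - t|)%:E) ->
  sqint (fun w => \sum_(e <- s) e.1 * (X e.2.2 w - X e.2.1 w)) =
  (K * increment_form s)%:E.
Proof.
move=> mX HX.
have H t t' : has_integral (fun w => (X t' w - X t w) ^+ 2) (K * `|t' - t|).
  by apply: has_integral_sqr; [exact: measurable_funB|exact: HX].
(* Polarization of a product of two increments into four squared increments between their end
   points; it covers overlapping intervals directly. *)
have HE e e' : has_integral (fun w => e.1 * e'.1 / 2 *
    ((X e'.2.1 w - X e.2.2 w) ^+ 2 + (X e'.2.2 w - X e.2.1 w) ^+ 2 +
     -1 * (X e'.2.2 w - X e.2.2 w) ^+ 2 + -1 * (X e'.2.1 w - X e.2.1 w) ^+ 2))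
  (e.1 * e'.1 / 2 * (K * `|e'.2.1 - e.2.2| + K * `|e'.2.2 - e.2.1| +
    -1 * (K * `|e'.2.2 - e.2.2|) + -1 * (K * `|e'.2.1 - e.2.1|))).
  by apply: has_integralZ; do 3?apply: has_integralD => //; apply: has_integralZ.
have [_ E] := has_integral_sum s (fun e => has_integral_sum s (HE e)).
rewrite /sqint; transitivity (\int[mu]_w (\sum_(e <- s) \sum_(e' <- s) e.1 * e'.1 / 2 *
    ((X e'.2.1 w - X e.2.2 w) ^+ 2 + (X e'.2.2 w - X e.2.1 w) ^+ 2 +
     -1 * (X e'.2.2 w - X e.2.2 w) ^+ 2 + -1 * (X e'.2.1 w - X e.2.1 w) ^+ 2))%:E)%E.
  apply: eq_integral => w _; congr EFin.
  rewrite expr2 mulr_suml; apply: eq_bigr => e _; rewrite mulr_sumr.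
  by apply: eq_bigr => e' _; field.
rewrite E; congr EFin; rewrite /increment_form mulr_sumr; apply: eq_bigr => e _.
by rewrite mulr_sumr; apply: eq_bigr => e' _; ring.
Qed.

(** Monotone convergence, and finiteness almost everywhere of a function with finite integral. The
    first conclusion allows the result to be iterated over a double series. *)
Lemma ae_nneseries_lty (f : nat -> T -> \bar R) (C : R) :
  (forall n, measurable_fun setT (f n)) -> (forall n w, (0 <= f n w)%E) ->
  (forall N, (\sum_(0 <= n < N) \int[mu]_w f n w <= C%:E)%E) ->
  (\int[mu]_w (\sum_(n <oo) f n w) <= C%:E)%E /\
  {ae mu, forall w, (\sum_(n <oo) f n w < +oo)%E}.
Proof.
move=> mf f0 H.
have HI : (\int[mu]_w (\sum_(n <oo) f n w) <= C%:E)%E.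
  rewrite integral_nneseries//; apply: lime_le; last by near=> N; exact: H.
  by apply: is_cvg_nneseries => n _ _; exact: integral_ge0.
have mS : measurable_fun setT (fun w => \sum_(n <oo) f n w)%E.
  by apply: ge0_emeasurable_sum => // n w _ _; exact: f0.
have S0 w : (0 <= \sum_(n <oo) f n w)%E by exact: nneseries_ge0.
split=> //.
have /integrable_ae : mu.-integrable setT (fun w => \sum_(n <oo) f n w)%E.
  apply/integrableP; split => //.
  under eq_integral do rewrite gee0_abs//.
  by apply: le_lt_trans HI _; rewrite ltry.
move=> /(_ measurableT); apply: filterS => w /(_ I).
by rewrite ge0_fin_numE.
Unshelve. all: end_near. Qed.

End SquareIntegrals.


(** * Independent pairs and their second moments *)

Section Independence.
Context {disp : measure_display} {T : measurableType disp} {R : realType}.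
Variable P : probability T R.
Implicit Types (U V : T -> R).

Definition indep_pair U V := forall A B : set R, measurable A -> measurable B ->
  P (U @^-1` A `&` V @^-1` B) = (P (U @^-1` A) * P (V @^-1` B))%E.

Definition eq_distr U V := forall A : set R, measurable A ->
  P (U @^-1` A) = P (V @^-1` A).

Lemma eq_distr_ge0_integral U V (f : R -> \bar R) :
  measurable_fun setT U -> measurable_fun setT V -> eq_distr U V ->
  measurable_fun setT f -> (forall x, (0 <= f x)%E) ->
  (\int[P]_w f (U w) = \int[P]_w f (V w))%E.
Proof.
move=> mU mV UV mf f0.
have E W (mW : measurable_fun setT W) :
    (\int[P]_w f (W w) = \int[pushforward P W]_x f x)%E.
  by apply/esym; exact: ge0_integral_pushforward.
by rewrite !E//; apply: eq_measure_integral => A mA _; exact: UV.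
Qed.

Lemma eq_distr_sqint U V :
  measurable_fun setT U -> measurable_fun setT V -> eq_distr U V ->
  sqint P U = sqint P V.
Proof.
move=> mU mV UV.
apply: (@eq_distr_ge0_integral U V (fun x => (x ^+ 2)%:E)) => //.
  by apply/measurable_EFinP; exact: measurable_funX.
by move=> x; rewrite lee_fin sqr_ge0.
Qed.

Lemma eq_distr_integral U V :
  measurable_fun setT U -> measurable_fun setT V -> eq_distr U V ->
  (\int[P]_w (U w)%:E = \int[P]_w (V w)%:E)%E.
Proof.
move=> mU mV UV; rewrite integralE [RHS]integralE.
have mE : measurable_fun setT (@EFin R) by exact/measurable_EFinP.
have Kp W : (\int[P]_x (fun x0 => (W x0)%:E)^\+ x = \int[P]_x (@EFin R)^\+ (W x))%E.
  by apply: eq_integral => x _; rewrite !funeposE.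
have Kn W : (\int[P]_x (fun x0 => (W x0)%:E)^\- x = \int[P]_x (@EFin R)^\- (W x))%E.
  by apply: eq_integral => x _; rewrite !funenegE.
rewrite !Kp !Kn; congr (_ - _)%E; apply: eq_distr_ge0_integral => //.
  exact: measurable_funepos.
exact: measurable_funeneg.
Qed.

Lemma sqint_integrable U : measurable_fun setT U -> (sqint P U < +oo)%E ->
  P.-integrable setT (EFin \o U).
Proof.
move=> mU fU; apply: (@le_integrable _ _ _ _ setT measurableT _ (fun w => 1%:E + (U w ^+ 2)%:E)%E).
- exact/measurable_EFinP.
- move=> w _; rewrite -EFinD /= !lee_fin (ger0_norm (_ : 0 <= 1 + U w ^+ 2)).
    rewrite -(real_normK (num_real (U w))).
    have := sqr_ge0 (`|U w| - 1); have := normr_ge0 (U w); rewrite !expr2; lra.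
  by rewrite addr_ge0// sqr_ge0.
- apply: integrableD => //; first exact: finite_measure_integrable_cst.
  apply/integrableP; split; first exact: measurable_sqr.
  by under eq_integral do rewrite /= ger0_norm ?sqr_ge0//.
Qed.

Lemma integral_cst_probability (c : \bar R) : (\int[P]_w c = c)%E.
Proof. by rewrite integral_cst//= probability_setT mule1. Qed.

Lemma indep_pair_sym U V : indep_pair U V -> indep_pair V U.
Proof. by move=> UV A B mA mB; rewrite setIC muleC UV. Qed.

(** Independence says that the joint law agrees with the product law on rectangles; uniqueness of
    the product measure and Tonelli do the rest. *)
Lemma indep_pair_tonelli U V (f : R * R -> \bar R) :
  measurable_fun setT U -> measurable_fun setT V -> indep_pair U V ->
  measurable_fun setT f -> (forall x, (0 <= f x)%E) ->
  (\int[P]_w f (U w, V w) = \int[P]_w \int[P]_w' f (U w, V w'))%E.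
Proof.
move=> mU mV UV mf f0.
have U1 : U \in mfun by rewrite inE.
have V1 : V \in mfun by rewrite inE.
pose PU : probability _ R := distribution P (mfun_Sub U1 : {RV P >-> R}).
pose PV : probability _ R := distribution P (mfun_Sub V1 : {RV P >-> R}).
have mUV : measurable_fun setT (fun w => (U w, V w)) by exact: measurable_fun_pair.
transitivity (\int[(PU \x PV)%E]_z f z)%E.
  transitivity (\int[pushforward P (fun w => (U w, V w))]_z f z)%E.
    by apply/esym; exact: ge0_integral_pushforward.
  apply: eq_measure_integral => A mA _; apply/esym.
  apply: (@product_measure_unique _ _ _ _ _ PU PV (pushforward P (fun w => (U w, V w)))) => //.
rewrite fubini_tonelli1//.
have -> : (\int[PU]_x fubini_F PV f x = \int[P]_w fubini_F PV f (U w))%E.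
  rewrite /PU ge0_integral_distribution//.
    exact: measurable_fun_fubini_tonelli_F.
  by move=> x; apply: integral_ge0 => y _; exact: f0.
apply: eq_integral => w _; rewrite /fubini_F /PV ge0_integral_distribution//.
exact: measurableT_comp.
Qed.

(** For fixed [w] the inner integral of the square of [U w + V] is [U w ^ 2 + v], as the cross term
    vanishes with the mean of [V]. *)
Lemma indep_pair_sqintD U V : measurable_fun setT U -> measurable_fun setT V ->
  indep_pair U V -> (sqint P V < +oo)%E -> (\int[P]_w (V w)%:E = 0)%E ->
  sqint P (fun w => U w + V w) = (sqint P U + sqint P V)%E.
Proof.
move=> mU mV UV fV V0; rewrite {1}/sqint.
rewrite (@indep_pair_tonelli U V (fun z => ((z.1 + z.2) ^+ 2)%:E))//; last 2 first.
- apply/measurable_EFinP; apply: measurable_funX.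
  by apply: measurable_funD; [exact: measurable_fst|exact: measurable_snd].
- by move=> z; rewrite lee_fin sqr_ge0.
have iV := sqint_integrable mV fV.
have [v Vv] : exists v, sqint P V = v%:E.
  by exists (fine (sqint P V)); rewrite fineK// ge0_fin_numE ?sqint_ge0.
have hV2 := has_integral_sqr mV Vv.
have hV : has_integral P V 0 by split.
have h1 c : has_integral P (fun=> c) c.
  split; first exact: finite_measure_integrable_cst.
  exact: integral_cst_probability.
have E w : (\int[P]_w' ((U w + V w') ^+ 2)%R%:E = (U w ^+ 2 + v)%:E)%E.
  have [_] := has_integralD (has_integralD (h1 (U w ^+ 2)) (has_integralZ (2 * U w) hV)) hV2.
  rewrite mulr0 addr0 => <-; apply: eq_integral => w' _; congr EFin; ring.
under eq_integral do rewrite /= E EFinD.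
rewrite ge0_integralD//.
- by rewrite integral_cst_probability Vv.
- by move=> w _; rewrite lee_fin sqr_ge0.
- exact: measurable_sqr.
- by move=> w _; rewrite -Vv sqint_ge0.
Qed.

(** By Tonelli some translate [U w + V] has finite second moment, and removing the constant [U w]
    preserves finiteness. *)
Lemma indep_pair_sqint_lty U V : measurable_fun setT U -> measurable_fun setT V ->
  indep_pair U V -> (sqint P (fun w => U w + V w)%R < +oo)%E -> (sqint P V < +oo)%E.
Proof.
move=> mU mV UV; rewrite {1}/sqint.
rewrite (@indep_pair_tonelli U V (fun z => ((z.1 + z.2) ^+ 2)%:E))//; last 2 first.
- apply/measurable_EFinP; apply: measurable_funX.
  by apply: measurable_funD; [exact: measurable_fst|exact: measurable_snd].
- by move=> z; rewrite lee_fin sqr_ge0.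
move=> /= fUV; have [w fw] : exists w, (sqint P (fun w' => U w + V w')%R < +oo)%E.
  apply: contrapT => /forallNP H; move: fUV.
  under eq_integral => w _.
    have -> : (\int[P]_w' ((U w + V w') ^+ 2)%R%:E = +oo)%E.
      by have /negP := H w; rewrite -leNgt leye_eq => /eqP.
    over.
  by rewrite integral_cst_probability ltxx.
rewrite (@eq_sqint _ _ _ P _ (fun w' => (U w + V w') + - U w)); last first.
  by move=> w'; rewrite addrC addKr.
apply: sqintD_lty => //.
- by apply: measurable_funD => //; exact: measurable_cst.
- rewrite /sqint integral_cst_probability; exact: ltry.
Qed.

End Independence.


(** * Second moments and left limits of a centred Levy process *)

Section LevyMoments.
Context {disp : measure_display} {T : measurableType disp} {R : realType}.
Variable P : probability T R.

Section process.
Variable X : R -> T -> R.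
Hypothesis X_levy : is_levy P X.
Hypothesis X_mean0 : forall t, 0 <= t -> (\int[P]_w (X t w)%:E = 0)%E.
Hypothesis X1_fin : (sqint P (X 1) < +oo)%E.

Let incr s t w := X t w - X s w.
Let mX t : 0 <= t -> measurable_fun setT (X t).
Proof. by case: X_levy => + _ _ _ _; apply. Qed.

Let mincr s t : 0 <= s -> 0 <= t -> measurable_fun setT (incr s t).
Proof. by move=> s0 t0; apply: measurable_funB; exact: mX. Qed.

Let ae_X0 t : {ae P, forall w, incr 0 t w = X t w}.
Proof.
by case: X_levy => _ + _ _ _; apply: filterS => w h; rewrite /incr h subr0.
Qed.

Let incr_indep s t u : 0 <= s -> s <= t -> t <= u ->
  indep_pair P (incr s t) (incr t u).
Proof.
move=> s0 st tu A B mA mB; case: X_levy => _ _ ii _ _.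
(* The definition asks for an infinite nondecreasing sequence of times, so [s, t, u] is continued by
   [u]; two increments are used. *)
pose tt i := if i is i'.+1 then (if i' is _.+1 then u else t) else s.
pose C i := if i is 0%N then A else B.
have tt_le i : tt i <= tt i.+1 by case: i => [|[|]].
have mC i : measurable (C i) by case: i.
have := ii 2%N tt C s0 tt_le mC.
rewrite !big_ord_recl big_ord0 mulr1 /=.
rewrite (_ : [set w | _] = incr s t @^-1` A `&` incr t u @^-1` B); last first.
  apply/seteqP; split=> [w h|w [hA hB] [|[|]]//].
  by split; [exact: (h 0%N)|exact: (h 1%N)].
have t0 : 0 <= t := le_trans s0 st; have u0 : 0 <= u := le_trans t0 tu.
have mI1 : measurable (incr s t @^-1` A).
  by rewrite -[X in measurable X]setTI; exact: mincr.
have mI2 : measurable (incr t u @^-1` B).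
  by rewrite -[X in measurable X]setTI; exact: mincr.
move=> E; rewrite -[LHS]fineK ?fin_num_measure//; last exact: measurableI.
rewrite {}E EFinM -/(incr s t @^-1` A) -/(incr t u @^-1` B).
by congr (_ * _)%E; apply: fineK; apply: fin_num_measure.
Qed.

Let incr_distr s t : 0 <= s -> s <= t -> eq_distr P (incr s t) (incr 0 (t - s)).
Proof.
move=> s0 st A mA; case: X_levy => _ _ _ si _.
have := si s (t - s) A s0 _ mA; rewrite subr_ge0 => /(_ st).
by rewrite addrC subrK.
Qed.

Let incr_mean s t : 0 <= s -> s <= t -> (\int[P]_w (incr s t w)%:E = 0)%E.
Proof.
move=> s0 st; have t0 : 0 <= t := le_trans s0 st.
have ts0 : 0 <= t - s by rewrite subr_ge0.
rewrite (eq_distr_integral (mincr s0 t0) (mincr (lexx 0) ts0) (incr_distr s0 st)).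
rewrite -(X_mean0 ts0); apply: ae_eq_integral => //.
- by apply/measurable_EFinP; exact: mincr.
- by apply/measurable_EFinP; exact: mX.
- by have := ae_X0 (t - s); apply: filterS => w /= ->.
Qed.

Let phi t := sqint P (incr 0 t).

Let incr_phi s t : 0 <= s -> s <= t -> sqint P (incr s t) = phi (t - s).
Proof.
move=> s0 st; apply: eq_distr_sqint; [| |exact: incr_distr].
  by apply: mincr => //; exact: le_trans st.
by apply: mincr; rewrite ?subr_ge0.
Qed.

Let incrD s t : incr 0 t =1 (fun w => incr 0 s w + incr s t w).
Proof. by move=> w; rewrite /incr; ring. Qed.

Let phi1 : (phi 1 < +oo)%E.
Proof.
rewrite /phi (@ae_eq_sqint _ _ _ P _ (X 1))//.
- by apply: mincr.
- exact: mX.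
Qed.

Let phi_nat n : (phi n%:R < +oo)%E.
Proof.
elim: n => [|n IH].
  rewrite /phi (@eq_sqint _ _ _ P _ (fun=> 0)); last by move=> w; rewrite /incr subrr.
  by rewrite /sqint expr0n/= integral0.
rewrite /phi (eq_sqint P (incrD n%:R n.+1%:R)).
apply: sqintD_lty => //; try exact: mincr.
by rewrite incr_phi ?ler_nat// -natrB// subSnn.
Qed.

(** The increment over [[0, t]] is an independent part of the increment up to an integer, whose
    second moment is finite by induction from time 1. *)
Let phi_fin t : 0 <= t -> (phi t < +oo)%E.
Proof.
move=> t0; set n := (Num.truncn t).+1.
have tn : t <= n%:R by apply: ltW; exact: truncnS_gt.
have n0 : 0 <= n%:R :> R by [].
apply: (@indep_pair_sqint_lty _ _ _ P (incr t n%:R)); try exact: mincr.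
  by apply: indep_pair_sym; exact: incr_indep.
rewrite (@eq_sqint _ _ _ P _ (incr 0 n%:R)) ?phi_nat// => w.
by rewrite addrC -incrD.
Qed.

Let phi_fineK t : 0 <= t -> (fine (phi t))%:E = phi t.
Proof. by move=> t0; rewrite fineK// ge0_fin_numE ?sqint_ge0// phi_fin. Qed.

Let phiD s t : 0 <= s -> 0 <= t -> fine (phi (s + t)) = fine (phi s) + fine (phi t).
Proof.
move=> s0 t0; have st0 : 0 <= s + t by rewrite addr_ge0.
have sst : s <= s + t by rewrite lerDl.
rewrite -fineD ?ge0_fin_numE ?sqint_ge0 ?phi_fin//; congr fine.
have e : sqint P (incr s (s + t)) = phi t by rewrite incr_phi// addrAC subrr add0r.
rewrite {1}/phi (eq_sqint P (incrD s (s + t))) indep_pair_sqintD ?e//; try exact: mincr.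
- exact: incr_indep.
- by rewrite phi_fin.
- exact: incr_mean.
Qed.

(** Cauchy's functional equation: [phi] is additive by independence of centred increments, and
    monotone because it is also nonnegative. *)
Let phi_linear t : 0 <= t -> fine (phi t) = t * fine (phi 1).
Proof.
have p0 u : 0 <= fine (phi u) by rewrite fine_ge0// sqint_ge0.
have pz : fine (phi 0) = 0.
  by have := phiD (lexx 0) (lexx 0); rewrite addr0; lra.
have pM n u : 0 <= u -> fine (phi (n%:R * u)) = n%:R * fine (phi u).
  move=> u0; elim: n => [|n IH]; first by rewrite !mul0r.
  by rewrite -natr1 !mulrDl !mul1r phiD ?IH// mulr_ge0.
have pmono u v : 0 <= u -> u <= v -> fine (phi u) <= fine (phi v).
  move=> u0 uv; rewrite -(subrK u v) addrC phiD// ?subr_ge0//.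
  by rewrite lerDl.
move=> t0; set c := fine (phi 1).
(* Squeezing [N * t] between consecutive integers bounds the deviation from linearity by [c / N],
   for every [N]. *)
have H n : `|fine (phi t) - t * c| * n.+1%:R <= c.
  set N := n.+1; have N0 : 0 < N%:R :> R by rewrite ltr0n.
  have Nt0 : 0 <= N%:R * t by rewrite mulr_ge0.
  set m := Num.truncn (N%:R * t).
  have [m1 m2] : m%:R <= N%:R * t /\ N%:R * t < m.+1%:R.
    by rewrite truncnS_gt; split => //; rewrite truncn_le.
  have e k : fine (phi k%:R) = k%:R * c by rewrite -{1}(mulr1 k%:R) pM.
  have h1 : m%:R * c <= N%:R * fine (phi t) by rewrite -e -pM// pmono.
  have h2 : N%:R * fine (phi t) <= m.+1%:R * c by rewrite -e -pM// pmono// ltW.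
  have c0 : 0 <= c := p0 1.
  have h3 : m%:R * c <= N%:R * t * c by rewrite ler_wpM2r.
  have h4 : N%:R * t * c <= m.+1%:R * c by rewrite ler_wpM2r// ltW.
  rewrite -[N%:R]gtr0_norm// -normrM mulrBl ler_norml.
  by move: h1 h2 h3 h4; rewrite -natr1; lra.
apply/eqP; rewrite -subr_eq0 -normr_eq0; apply/negPn/negP => n0.
have d0 : 0 < `|fine (phi t) - t * c| by rewrite lt_def n0 normr_ge0.
have := H (Num.truncn (c / `|fine (phi t) - t * c|)).
rewrite mulrC -ler_pdivlMr// leNgt.
by rewrite truncnS_gt.
Qed.

Lemma levy_sqint_incr s t : 0 <= s -> s <= t ->
  sqint P (fun w => X t w - X s w) = (fine (sqint P (X 1)) * (t - s))%:E.
Proof.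
move=> s0 st; have ts0 : 0 <= t - s by rewrite subr_ge0.
rewrite -[LHS]/(sqint P (incr s t)) incr_phi// -phi_fineK// phi_linear//.
rewrite mulrC; congr (_ * _)%:E; congr fine.
by apply: ae_eq_sqint; [exact: mincr|exact: mX|exact: ae_X0].
Qed.

Lemma levy_sqint t : 0 <= t -> sqint P (X t) = (fine (sqint P (X 1)) * t)%:E.
Proof.
move=> t0; have := levy_sqint_incr (lexx 0) t0; rewrite subr0 => <-.
apply/esym; apply: ae_eq_sqint; [exact: mincr|exact: mX|exact: ae_X0].
Qed.

(* The increments over [t - t / 2^n, t] have summable second moments, hence tend to 0 a.s. *)
Lemma levy_left_lim t : 0 < t ->
  {ae P, forall w, lim (X u w @[u --> t^'-]) = X t w}.
Proof.
move=> t0.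
pose tn n := t - t / 2 ^+ n.
have tn0 n : 0 <= tn n.
  by rewrite /tn subr_ge0 ler_pdivrMr ?exprn_gt0// ler_peMr ?(ltW t0)// exprn_ege1// ler1n.
have tnt n : tn n <= t by rewrite /tn gerBl divr_ge0 ?(ltW t0)// exprn_ge0.
have mD n : measurable_fun setT (fun w => (incr (tn n) t w ^+ 2)%:E).
  by apply: measurable_sqr; apply: mincr; [exact: tn0|exact: ltW].
have D0 n w : (0 <= (incr (tn n) t w ^+ 2)%:E)%E by rewrite lee_fin sqr_ge0.
set c := fine (sqint P (X 1)).
have c0 : 0 <= c by rewrite fine_ge0// sqint_ge0.
have HC N : (\sum_(0 <= n < N) \int[P]_w (incr (tn n) t w ^+ 2)%:E <= (c * t * 2)%:E)%E.
  rewrite (eq_bigr (fun n => (c * t / 2 ^+ n)%:E)); last first.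
    move=> n _; rewrite -[LHS]/(sqint P _) levy_sqint_incr//; congr EFin.
    by rewrite /tn -/c; ring.
  rewrite sumEFin lee_fin.
  have -> : \sum_(0 <= n < N) c * t / 2 ^+ n = c * t * (2 - 2 / 2 ^+ N).
    elim: N => [|N IH]; first by rewrite big_nil expr0 divr1 subrr mulr0.
    by rewrite big_nat_recr//= IH exprS; field; rewrite expf_neq0.
  by rewrite ler_wpM2l ?mulr_ge0 ?(ltW t0)// gerBl divr_ge0 ?exprn_ge0.
have [_] := ae_nneseries_lty mD D0 HC.
case: X_levy => _ _ _ _; apply: filterS2 => w [_ clg] fs.
(* [cadlag] provides the left limit [l]; the sequence [tn] serves to identify it with [X t w]. *)
have /cvg_ex[l Hl] := clg t t0; rewrite (cvg_lim _ Hl)//.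
have D_0 : incr (tn n) t w ^+ 2 @[n --> \oo] --> 0.
  apply: cvg_series_cvg_0; apply: nnseries_is_cvg => // n.
  exact: sqr_ge0.
have tn_t : tn n @[n --> \oo] --> t.
  rewrite -[X in _ --> X]subr0; apply: cvgB; first exact: cvg_cst.
  rewrite -[X in _ --> X](mulr0 t); apply: cvgM; first exact: cvg_cst.
  rewrite (_ : (fun n => _) = fun n => 2^-1 ^+ n); last by apply/funext => n; rewrite exprVn.
  by apply: cvg_expr; rewrite ger0_norm; lra.
have Xl : X (tn n) w @[n --> \oo] --> l.
  move/cvg_at_leftP: Hl; apply; split => // n.
  by rewrite /tn ltrBlDr ltrDl divr_gt0// exprn_gt0.
have Hc : incr (tn n) t w ^+ 2 @[n --> \oo] --> (X t w - l) ^+ 2.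
  by apply: cvgM; apply: cvgB => //; exact: cvg_cst.
have /eqP : (X t w - l) ^+ 2 = 0.
  by rewrite -(cvg_lim (@Rhausdorff R) Hc) (cvg_lim (@Rhausdorff R) D_0).
by rewrite sqrf_eq0 subr_eq0 => /eqP.
Qed.

End process.
End LevyMoments.


(** * Second moments of the two-sided driver *)

Section TwoSided.
Context {disp : measure_display} {T : measurableType disp} {R : realType}.
Variable P : probability T R.
Hypothesis P_complete : measure_is_complete P.
Variable L : R -> T -> R.
Hypothesis L_driver : flp_driver P L.

Lemma expectationE (X : T -> R) : ('E_P[X] = \int[P]_w (X w)%:E)%E.
Proof. by rewrite unlock. Qed.

(** Increments on one side of 0 reduce to a single Levy process; across 0 the two independent halves
    contribute [c * t] and [c * - s], again [c] times the length. *)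
Lemma two_sided_levy_moments : exists2 c, 0 <= c &
  (forall t, measurable_fun setT (L t)) /\
  (forall s t, sqint P (fun w => L t w - L s w) = (c * `|t - s|)%:E).
Proof.
have [[L1 [L2 [levy1 levy2 law ind LE]]] mean fin1 _] := L_driver.
have L1E t : 0 <= t -> L t = L1 t by move=> t0; apply/funext => w; rewrite LE t0.
have m1 t : 0 <= t -> measurable_fun setT (L1 t) by case: levy1 => + _ _ _ _; apply.
have m2 t : 0 <= t -> measurable_fun setT (L2 t) by case: levy2 => + _ _ _ _; apply.
have E1 t : 0 <= t -> (\int[P]_w (L1 t w)%:E = 0)%E.
  by move=> t0; rewrite -L1E// -expectationE mean.
have d12 t : 0 <= t -> eq_distr P (L2 t) (L1 t).
  move=> t0 A mA.
  have := law 1%N (fun=> t) (fun=> A) (fun=> t0) (fun=> mA).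
  have E X : finite_dim_event X 1 (fun=> t) (fun=> A) = X t @^-1` A.
    apply/seteqP; split=> [w h|w h [|]//]; exact: (h 0%N).
  by rewrite !E.
have E2 t : 0 <= t -> (\int[P]_w (L2 t w)%:E = 0)%E.
  by move=> t0; rewrite (eq_distr_integral (m2 _ t0) (m1 _ t0) (d12 _ t0)) E1.
have ind12 s t : 0 <= s -> 0 <= t -> indep_pair P (L1 s) (L2 t).
  move=> s0 t0 A B mA mB.
  have := ind 1%N (fun=> s) (fun=> A) 1%N (fun=> t) (fun=> B)
    (fun=> s0) (fun=> mA) (fun=> t0) (fun=> mB).
  have E X u C : finite_dim_event X 1 (fun=> u) (fun=> C) = X u @^-1` C :> set T.
    apply/seteqP; split=> [w h|w h [|]//]; exact: (h 0%N).
  by rewrite !E.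
have f1 : (sqint P (L1 1%R) < +oo)%E by rewrite -L1E// /sqint -expectationE.
have s21 : sqint P (L2 1) = sqint P (L1 1).
  exact: eq_distr_sqint (m2 _ ler01) (m1 _ ler01) (d12 _ ler01).
have f2 : (sqint P (L2 1%R) < +oo)%E by rewrite s21.
set c := fine (sqint P (L1 1)).
(* A version of [L] with the left limits replaced by values. It is measurable by construction and
   equals [L t] a.s. for each [t], so completeness of [P] transfers measurability to [L t]. *)
pose M t := if 0 <= t then L1 t else L2 (- t).
have mM t : measurable_fun setT (M t).
  by rewrite /M; case: (leP 0 t) => t0; [exact: m1|apply: m2; lra].
have LM t : {ae P, forall w, M t w = L t w}.
  rewrite /M; case: (leP 0 t) => t0.
    by apply: filterE => w; rewrite L1E.
  have := levy_left_lim levy2 E2 f2 (_ : 0 < - t); rewrite oppr_gt0 => /(_ t0).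
  by apply: filterS => w <-; rewrite LE leNgt t0.
have mL t : measurable_fun setT (L t).
  apply/measurable_EFinP; apply: (ae_measurable_fun P_complete (f := EFin \o M t)).
    by have := LM t; apply: filterS => w /= -> _.
  exact/measurable_EFinP.
exists c; first by rewrite fine_ge0// sqint_ge0.
split => // s t.
wlog st : s t / s <= t.
  have [st|/ltW st] := leP s t; first exact.
  by move=> /(_ _ _ st); rewrite sqintC distrC.
have -> : sqint P (fun w => L t w - L s w) = sqint P (fun w => M t w - M s w).
  apply: ae_eq_sqint; try exact: measurable_funB.
  by apply: filterS2 (LM t) (LM s) => w -> ->.
rewrite ger0_norm ?subr_ge0// /M.
case: (leP 0 s) => s0.
  rewrite (le_trans s0 st) (levy_sqint_incr levy1 E1 f1 s0 st)//.
case: (leP 0 t) => t0.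
  have s0' : 0 <= - s by lra.
  rewrite (_ : (fun w => L1 t w - L2 (- s) w) = (fun w => L1 t w + -1 * L2 (- s) w)); last first.
    by apply/funext => w; rewrite mulN1r.
  have mN : measurable_fun setT (fun w => -1 * L2 (- s) w).
    by apply: measurable_funM => //; exact: m2.
  have sN : sqint P (fun w => -1 * L2 (- s) w) = (c * - s)%:E.
    rewrite sqintZ; last exact: m2.
    by rewrite sqrrN expr1n mul1e (levy_sqint levy2 E2 f2 s0') s21.
  rewrite indep_pair_sqintD //.
  - by rewrite sN (levy_sqint levy1 E1 f1 t0) -EFinD -/c; congr EFin; ring.
  - exact: m1.
  - move=> A B mA mB; have mB' : measurable [set x : R | B (-1 * x)].
      rewrite -[X in measurable X]setTI.
      by have mm : measurable_fun setT (fun x : R => -1 * x) by [exact: measurable_funM];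
         exact: (mm measurableT B mB).
    exact: (ind12 _ _ t0 s0' A _ mA mB').
  - by rewrite sN ltry.
  - under eq_integral do rewrite EFinM.
    have i2 : P.-integrable setT (EFin \o L2 (- s)).
      apply: sqint_integrable; first exact: m2.
      by rewrite (levy_sqint levy2 E2 f2 s0') ltry.
    by rewrite (integralZl _ i2)// E2// mule0.
have t0' : 0 <= - t by lra.
have ts : - t <= - s by lra.
rewrite (sqintC P (L2 (- t)) (L2 (- s))) (levy_sqint_incr levy2 E2 f2 t0' ts).
by rewrite s21 -/c; congr EFin; ring.
Qed.

End TwoSided.

(** * Step functions as combinations of increments *)

Section StepFunctions.
Context {R : realType}.
Notation leb := (@lebesgue_measure R).

(** Seen as a process in [t] under Lebesgue measure, [H] has increments of squared norm [|t - s|],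
    so [sqint_increments] applies to step functions just as it does to integrals against [L]. *)
Let H (t x : R) : R := (x <= t)%R%:R.

Let mH t : measurable_fun setT (H t).
Proof.
rewrite (_ : H t = \1_`]-oo, t]); first exact: measurable_indic.
by apply/funext => x; rewrite indicE mem_setE/= in_itv.
Qed.

Let sqH s t : sqint leb (fun x => H t x - H s x) = (1 * `|t - s|)%:E.
Proof.
rewrite mul1r; wlog st : s t / s <= t.
  have [st|/ltW st] := leP s t; first exact.
  by move=> /(_ _ _ st); rewrite sqintC distrC.
rewrite /sqint (_ : (fun x => _) = (EFin \o \1_`]s, t])); last first.
  apply/funext => x /=; rewrite indicE mem_setE/= in_itv/= /H.
  have [xs|sx] := leP x s; first by rewrite (le_trans xs st) subrr expr0n.
  by case: (x <= t); rewrite subr0 ?expr1n ?expr0n.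
transitivity (lebesgue_measure [set` `]s, t]]).
  by rewrite -[in RHS](setIT [set` `]s, t]]); exact: integral_indic.
rewrite lebesgue_measure_itv/= lte_fin.
case: ltgtP st => // [st _|<- _]; last by rewrite subrr normr0.
by rewrite ger0_norm ?subr_ge0 ?(ltW st)// EFinB.
Qed.

Lemma step_funE (s : seq (R * (R * R))) x : all (fun e => e.2.1 <= e.2.2) s ->
  step_fun s x = \sum_(e <- s) e.1 * (H e.2.2 x - H e.2.1 x).
Proof.
move=> /allP hs; apply: eq_big_seq => e /hs; rewrite /H => le.
congr (_ * _); case: (leP x e.2.1) => xl /=; first by rewrite (le_trans xl le) subrr.
by rewrite subr0.
Qed.

Lemma sqint_step_fun (s : seq (R * (R * R))) : all (fun e => e.2.1 <= e.2.2) s ->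
  sqint leb (step_fun s) = (increment_form s)%:E.
Proof.
move=> hs; rewrite -[increment_form s]mul1r -(sqint_increments (mu := leb) _ mH sqH).
by apply: eq_sqint => x; rewrite step_funE.
Qed.

Lemma measurable_step_fun (s : seq (R * (R * R))) : all (fun e => e.2.1 <= e.2.2) s ->
  measurable_fun setT (step_fun s).
Proof.
move=> hs; rewrite (_ : step_fun s = fun x => \sum_(e <- s) e.1 * (H e.2.2 x - H e.2.1 x)).
  apply: measurable_sum => e; apply: measurable_funM => //.
  exact: measurable_funB.
by apply/funext => x; rewrite step_funE.
Qed.

Definition opp_step (s : seq (R * (R * R))) := [seq (- e.1, e.2) | e <- s].

Lemma step_funB s1 s2 x : step_fun (s1 ++ opp_step s2) x = step_fun s1 x - step_fun s2 x.
Proof.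
rewrite /step_fun big_cat/= big_map/= -sumrN; congr (_ + _).
by apply: eq_bigr => e _; rewrite mulNr.
Qed.

Lemma step_integralB {T : Type} (L : R -> T -> R) s1 s2 w :
  \sum_(e <- s1 ++ opp_step s2) e.1 * (L e.2.2 w - L e.2.1 w) =
  \sum_(e <- s1) e.1 * (L e.2.2 w - L e.2.1 w) -
  \sum_(e <- s2) e.1 * (L e.2.2 w - L e.2.1 w).
Proof.
rewrite big_cat/= big_map/= -[in RHS]sumrN; congr (_ + _).
by apply: eq_bigr => e _; rewrite mulNr.
Qed.

End StepFunctions.


(** * The Ito isometry and its passage to the limit *)

Section L2Integral.
Context {disp : measure_display} {T : measurableType disp} {R : realType}.
Variable P : probability T R.
Hypothesis P_complete : measure_is_complete P.
Variable L : R -> T -> R.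
Notation leb := (@lebesgue_measure R).
Variable c : R.
Hypothesis c0 : 0 <= c.
Hypothesis mL : forall t, measurable_fun setT (L t).
Hypothesis sqL : forall s t, sqint P (fun w => L t w - L s w) = (c * `|t - s|)%:E.

Let mSI s : measurable_fun setT (step_integral L s).
Proof.
by apply: measurable_sum => e; apply: measurable_funM => //; exact: measurable_funB.
Qed.

(** Both sides are the same [increment_form] of the concatenated data, with constants [c] and 1. *)
Let isometry s1 s2 : all (fun e => e.2.1 <= e.2.2) s1 -> all (fun e => e.2.1 <= e.2.2) s2 ->
  sqint P (fun w => step_integral L s1 w - step_integral L s2 w) =
  (c%:E * sqint leb (fun x => (step_fun s1 x - step_fun s2 x)%R))%E.
Proof.
move=> h1 h2; set s := s1 ++ opp_step s2.
have hs : all (fun e => e.2.1 <= e.2.2) s.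
  by rewrite all_cat h1 all_map.
rewrite (@eq_sqint _ _ _ P _ (fun w => \sum_(e <- s) e.1 * (L e.2.2 w - L e.2.1 w))); last first.
  by move=> w; rewrite /s step_integralB.
rewrite (sqint_increments s mL sqL) EFinM -(sqint_step_fun hs).
by congr (_ * _)%E; apply: eq_sqint => x; rewrite step_funB.
Qed.

Lemma sqint_L2_integralB (k1 k2 : R -> R) (Y1 Y2 : T -> R) :
  measurable_fun setT k1 -> measurable_fun setT k2 ->
  is_L2_integral P L k1 Y1 -> is_L2_integral P L k2 Y2 ->
  (sqint P (fun w => Y1 w - Y2 w)%R <=
   (4 * c)%:E * sqint leb (fun x => k1 x - k2 x)%R)%E.
Proof.
move=> mk1 mk2 [mY1 [s1 [h1 A1 B1]]] [mY2 [s2 [h2 A2 B2]]].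
apply/lee_addgt0Pr => e e0.
(* Approximation costs [8 * e1] under Lebesgue measure, multiplied by [2 * c] through the isometry,
   plus [8 * e1] under [P]: in all [(16 * c + 8) * e1 = e]. *)
pose e1 := e / (16 * c + 8).
have c8 : 0 < 16 * c + 8 by rewrite ltr_wpDl// mulr_ge0.
have e10 : 0 < e1 by rewrite divr_gt0.
have e1E : (0%:E < e1%:E)%E by rewrite lte_fin.
have : \forall n \near \oo,
   [/\ (sqint leb (fun x => step_fun (s1 n) x - k1 x)%R <= e1%:E)%E,
      (sqint leb (fun x => step_fun (s2 n) x - k2 x)%R <= e1%:E)%E,
      (sqint P (fun w => step_integral L (s1 n) w - Y1 w)%R <= e1%:E)%E &
      (sqint P (fun w => step_integral L (s2 n) w - Y2 w)%R <= e1%:E)%E].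
  near=> n; split; apply: ltW.
  - by near: n; exact: (A1 _ (open_ereal_lt' e1E)).
  - by near: n; exact: (A2 _ (open_ereal_lt' e1E)).
  - rewrite /sqint -expectationE; near: n; exact: (B1 _ (open_ereal_lt' e1E)).
  - rewrite /sqint -expectationE; near: n; exact: (B2 _ (open_ereal_lt' e1E)).
move=> /filter_ex[n [a1 a2 b1 b2]].
have mS1 := measurable_step_fun (h1 n); have mS2 := measurable_step_fun (h2 n).
have I := isometry (h1 n) (h2 n).
have step1 : (sqint leb (fun x => step_fun (s1 n) x - step_fun (s2 n) x)%R <=
    2%:E * sqint leb (fun x => k1 x - k2 x)%R + (8 * e1)%:E)%E.
  by apply: sqintB_approx_le; rewrite // sqintC.
have step2 : (sqint P (fun w => Y1 w - Y2 w)%R <=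
    2%:E * sqint P (fun w => step_integral L (s1 n) w - step_integral L (s2 n) w)%R + (8 * e1)%:E)%E.
  exact: sqintB_approx_le.
apply: le_trans step2 _; rewrite I.
set K := sqint leb _ in step1 *; set K1 := sqint leb (fun x => k1 x - k2 x) in step1 *.
have K10 : (0 <= K1)%E by exact: sqint_ge0.
apply: (@le_trans _ _ (2%:E * (c%:E * (2%:E * K1 + (8 * e1)%:E)) + (8 * e1)%:E)%E).
  by apply: leeD => //; apply: lee_wpmul2l => //; apply: lee_wpmul2l => //; rewrite lee_fin.
rewrite ge0_muleDr ?mule_ge0 ?lee_fin//; last by lra.
rewrite ge0_muleDr ?mule_ge0 ?lee_fin//; last by rewrite mulr_ge0//; lra.
rewrite -addeA; apply: leeD.
  by rewrite !muleA -!EFinM (_ : 2 * c * 2 = 4 * c)//; ring.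
rewrite -!EFinM -EFinD lee_fin le_eqVlt; apply/orP; left; apply/eqP.
by rewrite /e1; field; rewrite gt_eqF.
Unshelve. all: end_near. Qed.

End L2Integral.

(** * The L2 modulus of continuity of the fractional kernel *)

Section Kernel.
Context {R : realType}.
Notation leb := (@lebesgue_measure R).
Variable d : R.
Hypothesis d01 : 0 < d < 2^-1.

Lemma measurable_pos_pow t : measurable_fun setT (fun u : R => pos_pow (t - u) d).
Proof.
rewrite /pos_pow; apply: (measurableT_comp (measurable_powR d)).
apply: measurable_maxr => //; exact: measurable_funB.
Qed.

Lemma measurable_pos_powN : measurable_fun setT (fun u : R => pos_pow (- u) d).
Proof.
rewrite (_ : (fun u => _) = fun u => pos_pow (0 - u) d); first exact: measurable_pos_pow.
by apply/funext => u; rewrite sub0r.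
Qed.

Lemma pos_powE (x : R) : 0 <= x -> pos_pow x d = x `^ d.
Proof. by move=> x0; rewrite /pos_pow (max_idPl x0). Qed.

Lemma pos_pow0 (x : R) : x <= 0 -> pos_pow x d = 0.
Proof.
by move=> x0; rewrite /pos_pow (max_idPr x0) powR0// gt_eqF//; case/andP: d01.
Qed.

(** Factor out [x] and use that a number at least 1 dominates its power [d], as [d <= 1]. *)
Lemma powRD_far (x h : R) : 0 < x -> 0 <= h -> `|(x + h) `^ d - x `^ d| <= h * x `^ (d - 1).
Proof.
move=> x0 h0; have [d0 d1] := andP d01.
have E : x + h = x * (1 + h / x) by field; rewrite gt_eqF.
have h1 : 1 <= 1 + h / x by rewrite lerDl divr_ge0// ltW.
rewrite ger0_norm; last first.
  rewrite subr_ge0; apply: ge0_ler_powR; rewrite ?nnegrE ?addr_ge0 ?lerDl// ltW//.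
rewrite E powRM ?(ltW x0) ?(le_trans ler01 h1)// -[X in _ - X]mulr1 -mulrBr.
apply: (@le_trans _ _ (x `^ d * (h / x))).
  rewrite ler_wpM2l ?powR_ge0// lerBlDl ler1_powR//; lra.
rewrite -(mulr_powRB1 (ltW x0) d0) le_eqVlt; apply/orP; left; apply/eqP.
by field; rewrite gt_eqF.
Qed.

Lemma kernel_near (s t u : R) : s < t -> s - (t - s) < u ->
  (pos_pow (t - u) d - pos_pow (s - u) d) ^+ 2 <= (2 * (t - s)) `^ (2 * d).
Proof.
move=> st su; have [d0 d1] := andP d01.
have mono x y : x <= y -> pos_pow x d <= pos_pow y d.
  move=> xy; apply: ge0_ler_powR; first exact: ltW.
  - by rewrite nnegrE le_max lexx orbT.
  - by rewrite nnegrE le_max lexx orbT.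
  - by rewrite ge_max; apply/andP; split; rewrite le_max ?xy ?lexx ?orbT.
have h0 : 0 <= 2 * (t - s) by lra.
have m1 : pos_pow (t - u) d <= (2 * (t - s)) `^ d.
  by rewrite -(pos_powE h0); apply: mono; lra.
have m2 : pos_pow (s - u) d <= pos_pow (t - u) d by apply: mono; lra.
have m3 : 0 <= pos_pow (s - u) d by exact: powR_ge0.
rewrite (mulrC 2 d) powRrM powR_mulrn ?powR_ge0// ler_pXn2r ?nnegrE ?powR_ge0 ?subr_ge0//.
by rewrite lerBlDr; apply: le_trans m1 _; rewrite lerDl.
Qed.

(** The exponent is kept as [2 * d - 1 - 1] to match [q - 1] with [q = 2 * d - 1] in
    [integral_power_tail]. *)
Lemma kernel_far (s t u : R) : s < t -> u <= s - (t - s) ->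
  (pos_pow (t - u) d - pos_pow (s - u) d) ^+ 2 <= (t - s) ^+ 2 * (s - u) `^ (2 * d - 1 - 1).
Proof.
move=> st us; have su0 : 0 < s - u by lra.
rewrite !pos_powE; [|lra|lra].
rewrite (_ : t - u = (s - u) + (t - s)); last by ring.
have ts0 : 0 <= t - s by lra.
have := powRD_far su0 ts0; rewrite -(@ler_pXn2r _ 2)// ?nnegrE ?mulr_ge0 ?powR_ge0//.
rewrite real_normK ?num_real// exprMn.
rewrite -(@powR_mulrn _ ((s - u) `^ (d - 1)) 2 (powR_ge0 _ _)) -powRrM.
by rewrite (_ : (d - 1) * 2 = 2 * d - 1 - 1); last by ring.
Qed.

Lemma powR_cvgy0 (q : R) : q < 0 -> y `^ q @[y --> +oo] --> 0.
Proof.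
move=> q0; apply/cvgrPdist_le => e e0; near=> y.
have y0 : 0 < y by near: y; apply: nbhs_pinfty_gt; rewrite num_real.
have ey : e^-1 `^ (- q)^-1 <= y by near: y; apply: nbhs_pinfty_ge; rewrite num_real.
rewrite sub0r normrN ger0_norm ?powR_ge0//.
rewrite -[q]opprK powRN -[e]invrK lef_pV2 ?posrE ?invr_gt0 ?powR_gt0//.
have e1 : 0 <= e^-1 by rewrite invr_ge0 ltW.
rewrite -[leLHS](powRr1 e1) -(mulVf (lt0r_neq0 (_ : 0 < - q))) ?oppr_gt0// powRrM.
apply: ge0_ler_powR; rewrite ?nnegrE ?powR_ge0 ?oppr_ge0 ?(ltW y0) ?(ltW q0)//.
Unshelve. all: end_near. Qed.

Lemma integral_power_tail (s h q : R) : 0 < h -> q < 0 ->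
  (\int[leb]_(u in `]-oo, (s - h)%R]) ((s - u) `^ (q - 1))%:E = (h `^ q / - q)%:E)%E.
Proof.
move=> h0 q0.
have D y : - s < y -> is_derive y 1 (fun y => (s + y) `^ q / q) ((s + y) `^ (q - 1)).
  move=> sy; have sy0 : 0 < s + y by lra.
  have D1 : is_derive y 1 (fun y => s + y) 1.
    by rewrite -[X in is_derive _ _ _ X]add0r; exact: is_deriveD.
  have D2 := @is_derive1_comp R (fun z => z `^ q) (fun y => s + y) y _ _ (@is_derive1_powR R q _ sy0) D1.
  rewrite (_ : (fun y => (s + y) `^ q / q) = q^-1 \*: ((fun z => z `^ q) \o (fun y => s + y))); last first.
    by apply/funext => z /=; rewrite mulrC.
  rewrite (_ : (s + y) `^ (q - 1) = q^-1 *: (q * (s + y) `^ (q - 1) * 1)); last first.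
    by rewrite /GRing.scale/= mulr1 mulKf// lt_eqF.
  exact: is_deriveZ.
have cp y : - s < y -> {for y, continuous (fun y => (s + y) `^ (q - 1))}.
  move=> sy; have sy0 : 0 < s + y by lra.
  apply: (@continuous_comp _ _ _ (fun y => s + y) (fun z => z `^ (q - 1))).
    by apply: cvgD; [exact: cvg_cst|exact: cvg_id].
  apply: differentiable_continuous; apply/derivable1_diffP.
  by have [] := @is_derive1_powR R (q - 1) _ sy0.
have cG : {within `]-oo, (- (h - s))%R], continuous (fun u => (s - u) `^ (q - 1))}.
  apply: continuous_in_subspaceT => u; rewrite inE/= in_itv/= => us.
  apply: (@continuous_comp _ _ _ (fun u => - u) (fun y => (s + y) `^ (q - 1))).
    exact: opp_continuous.
  by apply: cp; lra.
(* The substitution u = - y leads to a ray towards +oo, where the primitive (s + y)^q / q vanishes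
   at infinity because q < 0. *)
rewrite (_ : s - h = - (h - s)); last by ring.
rewrite ge0_integration_by_substitutionNy//; last by move=> u _ ; exact: powR_ge0.
rewrite /comp; under eq_integral do rewrite opprK.
rewrite (@ge0_continuous_FTC2y _ _ (fun y => (s + y) `^ q / q) _ 0).
- by rewrite -EFinB sub0r subrKC invrN mulrN.
- by move=> y _; exact: powR_ge0.
- apply: continuous_in_subspaceT => y; rewrite inE/= in_itv/= andbT => hy.
  by apply: cp; lra.
- rewrite -(mul0r q^-1); apply: cvgM; last exact: cvg_cst.
  exact: (cvg_comp _ _ (cvg_addrl s) (powR_cvgy0 q0)).
- move=> y hy; have sy : - s < y by lra.
  by have [] := D y sy.
- have shs : - s < h - s by lra.
  have cF : {for h - s, continuous (fun y => (s + y) `^ q / q)}.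
    apply: differentiable_continuous; apply/derivable1_diffP.
    by have [] := D _ shs.
  exact: cvg_at_right_filter cF.
- move=> y; rewrite in_itv/= andbT => hy; rewrite derive1E.
  have sy : - s < y by lra.
  by have [_ ->] := D y sy.
Qed.

(** Cut at distance h = t - s to the left of [s]. The near part has length 2 h and integrand at most
    (2 h)^(2 d); the far part is the tail of h^2 (s - u)^(2 d - 2), integrable at -oo because d <
    1/2. Each contributes one summand of [C]. *)
Lemma sqint_kernel_le : exists2 C, 0 <= C & forall s t : R, s < t ->
  (sqint leb (fun u => pos_pow (t - u) d - pos_pow (s - u) d)%R <=
   (C * ((t - s) * (t - s) `^ (2 * d)))%:E)%E.
Proof.
have [d0 d1] := andP d01; have q0 : 2 * d - 1 < 0 by lra.
exists (2 * 2 `^ (2 * d) + (1 - 2 * d)^-1).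
  by rewrite addr_ge0// ?mulr_ge0 ?powR_ge0// invr_ge0; lra.
move=> s t st; set h := t - s.
have h0 : 0 < h by rewrite subr_gt0.
pose A : set R := [set` `]s - h, t]]; pose B : set R := [set` `]-oo, s - h]].
have mA : measurable A by exact: measurable_itv.
have mB : measurable B by exact: measurable_itv.
pose g u : R := h ^+ 2 * (s - u) `^ (2 * d - 1 - 1).
have mg : measurable_fun setT g.
  apply: measurable_funM => //.
  by apply: (measurableT_comp (measurable_powR _)); exact: measurable_funB.
have g0 u : 0 <= g u by rewrite mulr_ge0 ?exprn_ge0 ?powR_ge0// ltW.
have mf : measurable_fun setT (fun u : R => pos_pow (t - u) d - pos_pow (s - u) d).
  by apply: measurable_funB; exact: measurable_pos_pow.
apply: (@le_trans _ _ (\int[leb]_u (((2 * h) `^ (2 * d) * \1_A u)%:E + ((g \_ B) u)%:E))%E).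
  apply: ge0_le_integral => //.
  - by move=> u _; rewrite lee_fin sqr_ge0.
  - exact: measurable_sqr.
  - apply: emeasurable_funD; apply/measurable_EFinP.
      by apply: measurable_funM; [exact: measurable_cst|exact: measurable_indic].
    by apply/(measurable_restrictT _ mB); exact: measurable_funTS.
  - move=> u _; rewrite -EFinD lee_fin indicE patchE !mem_setE/= !in_itv/=.
    have [us|su] := leP u (s - h); first by rewrite mulr0 add0r; exact: kernel_far.
    rewrite addr0 /=; have [ut|tu] := leP u t; first by rewrite mulr1; exact: kernel_near.
    by rewrite mulr0 !pos_pow0 ?subrr ?expr0n//; lra.
rewrite ge0_integralD//; last 4 first.
- by move=> u _; rewrite lee_fin mulr_ge0 ?powR_ge0.
- by apply/measurable_EFinP; apply: measurable_funM => //; exact: measurable_indic.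
- by move=> u _; rewrite lee_fin patchE; case: ifP.
- by apply/measurable_EFinP; apply/(measurable_restrictT _ mB); exact: measurable_funTS.
have -> : (\int[leb]_u ((2 * h) `^ (2 * d) * \1_A u)%:E = ((2 * h) `^ (2 * d) * (2 * h))%:E)%E.
  under eq_integral do rewrite EFinM.
  rewrite ge0_integralZl_EFin ?powR_ge0//; last by apply/measurable_EFinP; exact: measurable_indic.
  rewrite EFinM; congr (_ * _)%E.
  transitivity (lebesgue_measure [set` `]s - h, t]]).
    by rewrite -[in RHS](setIT [set` `]s - h, t]]); exact: integral_indic.
  rewrite lebesgue_measure_itv/= lte_fin ifT; last by lra.
  by rewrite -EFinB /h; congr EFin; ring.
have -> : (\int[leb]_u ((g \_ B) u)%:E = (h ^+ 2 * (h `^ (2 * d - 1) / - (2 * d - 1)))%:E)%E.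
  rewrite EFinM -(integral_power_tail s h0 q0) -ge0_integralZl_EFin ?exprn_ge0 ?(ltW h0)//.
  - by rewrite [RHS]integral_mkcond; apply: eq_integral => u _; rewrite !patchE; case: ifP.
  - by move=> u _; rewrite lee_fin powR_ge0.
  - apply/measurable_EFinP; apply: measurable_funTS.
    by apply: (measurableT_comp (measurable_powR _)); exact: measurable_funB.
rewrite -EFinD lee_fin powRM ?(ltW h0)//.
rewrite -(mulr_powRB1 (ltW h0) (_ : 0 < 2 * d)); last by lra.
rewrite opprB le_eqVlt; apply/orP; left; apply/eqP; ring.
Qed.

End Kernel.


(** * Almost sure growth of fractional Levy paths at minus infinity *)

Section Growth.
Context {R : realType}.

Lemma sum_geometric_le (x : R) (N : nat) : 0 <= x < 1 ->
  \sum_(0 <= k < N) x ^+ k <= (1 - x)^-1.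
Proof.
move=> /andP[x0 x1]; have x10 : 0 < 1 - x by rewrite subr_gt0.
have -> : \sum_(0 <= k < N) x ^+ k = (1 - x ^+ N) / (1 - x).
  elim: N => [|N IH]; first by rewrite big_nil expr0 subrr mul0r.
  by rewrite big_nat_recr//= IH exprS; field; rewrite gt_eqF.
by rewrite ler_piMl ?invr_ge0 ?(ltW x10)// gerBl exprn_ge0.
Qed.

Context {disp : measure_display} {T : measurableType disp}.
Variable P : probability T R.

Lemma ae_foralln (Q : nat -> T -> Prop) : (forall n, {ae P, forall w, Q n w}) ->
  {ae P, forall w n, Q n w}.
Proof.
move=> H; apply: negligibleS (negligible_bigcup H) => w /= /existsNP[n nQ].
by exists n.
Qed.

(* The Kolmogorov-Chentsov argument: the second moments of the dyadic increments are summable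
   against the chosen weights, so the weighted sum of their squares is a.s. finite. *)
Lemma ae_dyadic_bound (Y : R -> T -> R) (d lam K : R) :
  0 < d -> 0 < lam -> 0 <= K ->
  (forall t, measurable_fun setT (Y t)) ->
  (forall s t, s < t -> (sqint P (fun w => Y t w - Y s w)%R <=
     (K * ((t - s) * (t - s) `^ (2 * d)))%:E)%E) ->
  {ae P, forall w, exists2 B, 0 <= B & forall n k j, (j < 2 ^ k)%N ->
    `|dyadic_incr (Y ^~ w) (- n.+1%:R) k j| <=
      B * expR (lam / 2) ^+ n * (2^-1 `^ (d / 2)) ^+ k}.
Proof.
move=> d0 l0 K0 mY HY.
(* With this [rho], an increment of level k has second moment at most K 2^(- k) rho^(4 k). The 2^k
   of them on one unit interval, weighted by rho^(- 2 k), leave K rho^(2 k), which is summable. *)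
set th := expR (lam / 2); set rho := 2^-1 `^ (d / 2).
have th1 : 1 < th by rewrite expR_gt1 divr_gt0.
have th0 : 0 < th by exact: lt_trans th1.
have rho0 : 0 < rho by rewrite powR_gt0.
have rho1 : rho < 1.
  have e1 : 1 `^ (d / 2) = 1 :> R by rewrite powR1.
  by rewrite -[X in _ < X]e1 gt0_ltr_powR ?divr_gt0// ?nnegrE//; lra.
have rho21 : 0 <= rho ^+ 2 < 1.
  by rewrite exprn_ge0 ?(ltW rho0)//= exprn_ilt1 ?(ltW rho0).
(* The moment bounds are the same on every unit interval, so any summable weight in [n] works; this
   one becomes the growth factor [th ^ n] after taking square roots. *)
set a := th ^- 2.
have a01 : 0 <= a < 1.
  by rewrite invr_ge0 exprn_ge0 ?(ltW th0)//= invf_lt1 ?exprn_gt0// exprn_egt1.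
have a0 : 0 <= a by case/andP: a01.
pose D n k j w := dyadic_incr (Y ^~ w) (- n.+1%:R) k j.
have mD n k j : measurable_fun setT (D n k j) by exact: measurable_funB.
have sqD n k j : (sqint P (D n k j) <= (K * (2 ^- k * rho ^+ (4 * k)))%:E)%E.
  have h : - n.+1%:R + j%:R / 2 ^+ k < - n.+1%:R + j.+1%:R / 2 ^+ k :> R.
    by rewrite ltrD2l ltr_pM2r ?invr_gt0 ?exprn_gt0// ltr_nat.
  apply: le_trans (HY _ _ h) _; rewrite lee_fin.
  have -> : - n.+1%:R + j.+1%:R / 2 ^+ k - (- n.+1%:R + j%:R / 2 ^+ k) = 2 ^- k :> R.
    by rewrite -(natr1 j); ring.
  rewrite -exprVn -[in X in _ * (_ * X) <= _]powR_mulrn// -powRrM.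
  by rewrite /rho -powR_mulrn ?powR_ge0// -powRrM natrM (_ : d / 2 * (4%:R * k%:R) = k%:R * (2 * d))//; field.
pose F n k w := ((rho ^- 2) ^+ k * \sum_(0 <= j < 2 ^ k) D n k j w ^+ 2)%:E.
have F0 n k w : (0 <= F n k w)%E.
  rewrite lee_fin mulr_ge0 ?exprn_ge0 ?invr_ge0 ?exprn_ge0 ?(ltW rho0)//.
  by apply: sumr_ge0 => j _; exact: sqr_ge0.
have mF n k : measurable_fun setT (F n k).
  apply/measurable_EFinP; apply: measurable_funM => //.
  by apply: measurable_sum => j; exact: measurable_funX.
have iF n k : (\int[P]_w F n k w <= (K * (rho ^+ 2) ^+ k)%:E)%E.
  rewrite /F; under eq_integral do rewrite EFinM -sumEFin.
  rewrite ge0_integralZl_EFin ?exprn_ge0 ?invr_ge0 ?exprn_ge0 ?(ltW rho0)//; last 2 first.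
  - by move=> w _; apply: sume_ge0 => j _; rewrite lee_fin sqr_ge0.
  - by apply: emeasurable_sum => j; exact: measurable_sqr.
  rewrite ge0_integral_sum//; last 2 first.
  - by move=> j; exact: measurable_sqr.
  - by move=> j w _; rewrite lee_fin sqr_ge0.
  apply: (@le_trans _ _ (((rho ^- 2) ^+ k)%:E *
      \sum_(0 <= j < 2 ^ k) (K * (2 ^- k * rho ^+ (4 * k)))%:E)%E).
    apply: lee_wpmul2l; first by rewrite lee_fin exprn_ge0 ?invr_ge0 ?exprn_ge0 ?(ltW rho0).
    by apply: lee_sum => j _; exact: sqD.
  rewrite sumEFin -EFinM lee_fin sumr_const_nat subn0 -[X in _ * X <= _]mulr_natl natrX.
  rewrite le_eqVlt; apply/orP; left; apply/eqP.
  have r0 : rho != 0 by rewrite gt_eqF.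
  rewrite (_ : (4 * k = 2 * k + 2 * k)%N); last by rewrite -mulnDl.
  by rewrite exprD -!exprM exprVn -exprM; field; rewrite !expf_neq0.
set C := K / (1 - rho ^+ 2).
have C0 : 0 <= C by rewrite divr_ge0// subr_ge0; case/andP: rho21 => _ /ltW.
have sF n N : (\sum_(0 <= k < N) \int[P]_w F n k w <= C%:E)%E.
  apply: le_trans (lee_sum _ (fun k _ => iF n k)) _.
  by rewrite sumEFin lee_fin -mulr_sumr ler_wpM2l// sum_geometric_le.
have iS n := (ae_nneseries_lty (mF n) (F0 n) (sF n)).1.
pose S n w := ((a ^+ n)%:E * \sum_(k <oo) F n k w)%E.
have mS' n : measurable_fun setT (fun w => \sum_(k <oo) F n k w)%E.
  by apply: ge0_emeasurable_sum => // k w _ _; exact: F0.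
have S'0 n w : (0 <= \sum_(k <oo) F n k w)%E by apply: nneseries_ge0 => k _ _; exact: F0.
have mS n : measurable_fun setT (S n) by exact: measurable_funeM.
have S0 n w : (0 <= S n w)%E by rewrite mule_ge0// lee_fin exprn_ge0.
have sS N : (\sum_(0 <= n < N) \int[P]_w S n w <= (C / (1 - a))%:E)%E.
  apply: (@le_trans _ _ (\sum_(0 <= n < N) (C * a ^+ n)%:E)%E).
    apply: lee_sum => n _; rewrite /S ge0_integralZl_EFin ?exprn_ge0//.
    by rewrite mulrC EFinM; apply: lee_wpmul2l => //; rewrite lee_fin exprn_ge0.
  by rewrite sumEFin lee_fin -mulr_sumr ler_wpM2l// sum_geometric_le.
have := (ae_nneseries_lty mS S0 sS).2; apply: filterS => w Zfin.
set Z := (\sum_(n <oo) S n w)%E in Zfin.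
have Z0 : (0 <= Z)%E by exact: nneseries_ge0.
have ZE : Z = (fine Z)%:E by rewrite fineK// ge0_fin_numE.
exists (Num.sqrt (fine Z)); first exact: sqrtr_ge0.
move=> n k j jk; rewrite -/(D n k j w).
have le1 : ((a ^+ n * ((rho ^- 2) ^+ k * D n k j w ^+ 2))%:E <= Z)%E.
  apply: (@le_trans _ _ (S n w)).
    rewrite EFinM; apply: lee_wpmul2l; first by rewrite lee_fin exprn_ge0.
    apply: (@le_trans _ _ (F n k w)).
      rewrite lee_fin ler_wpM2l ?exprn_ge0 ?invr_ge0 ?exprn_ge0 ?(ltW rho0)//.
      rewrite (big_rem j)/=; last by rewrite mem_index_iota.
      by rewrite lerDl sumr_ge0// => i _; exact: sqr_ge0.
    (* The partial sum up to [k.+1] is the first to contain the term of index [k]; likewise for [n]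
       below. *)
    apply: le_trans (nneseries_lim_ge k.+1 _) => [|i _ _]; last exact: F0.
    by rewrite big_nat_recr//= leeDr// sume_ge0.
  apply: le_trans (nneseries_lim_ge n.+1 _) => [|i _ _]; last exact: S0.
  by rewrite big_nat_recr//= leeDr// sume_ge0.
move: le1; rewrite ZE lee_fin => le1.
have fZ0 : 0 <= fine Z by rewrite fine_ge0.
rewrite -(@ler_pXn2r _ 2)// ?nnegrE ?mulr_ge0 ?sqrtr_ge0 ?exprn_ge0 ?(ltW th0) ?(ltW rho0)//.
rewrite real_normK ?num_real// !exprMn sqr_sqrtr//.
have p1 : 0 < (th ^+ n) ^+ 2 by rewrite !exprn_gt0.
have p2 : 0 < (rho ^+ k) ^+ 2 by rewrite !exprn_gt0.
rewrite -ler_pdivrMr// -ler_pdivrMr//; apply: le_trans le1.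
rewrite le_eqVlt; apply/orP; left; apply/eqP.
rewrite /a !exprVn (exprAC _ 2 n) (exprAC _ 2 k); field.
by rewrite !expf_neq0 ?gt_eqF.
Qed.

Hypothesis P_complete : measure_is_complete P.

(** In a difference of two kernels the common term [pos_pow (- s) d] cancels, leaving the shifted
    powers estimated by [sqint_kernel_le]. *)
Lemma flp_growth (d lam : R) (L Ld : R -> T -> R) : 0 < d < 2^-1 -> 0 < lam ->
  is_flp P d L Ld ->
  {ae P, forall w, exists D, forall t, t <= 0 -> `|Ld t w| <= D * expR (- (lam * t / 2))}.
Proof.
move=> d01 l0 [drv L2 cont _]; have [d0 d1] := andP d01.
have [c c0 [mL sqL]] := two_sided_levy_moments P_complete drv.
have [C C0 HC] := sqint_kernel_le d01.
have /choice[Y HY] : forall t, exists Y,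
    is_L2_integral P L (fun s => pos_pow (t - s) d - pos_pow (- s) d) Y /\
    {ae P, forall w, Ld t w = (Gamma (d + 1))^-1 * Y w}.
  by move=> t; have [Y ? ?] := L2 t; exists Y.
have mk t : measurable_fun setT (fun s : R => pos_pow (t - s) d - pos_pow (- s) d).
  by apply: measurable_funB; [exact: measurable_pos_pow|exact: measurable_pos_powN].
have mY t : measurable_fun setT (Y t) by have [[]] := HY t.
have sY s t : s < t -> (sqint P (fun w => Y t w - Y s w)%R <=
     (4 * c * C * ((t - s) * (t - s) `^ (2 * d)))%:E)%E.
  move=> st; apply: le_trans (sqint_L2_integralB c0 mL sqL (mk t) (mk s) (HY t).1 (HY s).1) _.
  rewrite -(mulrA (4 * c) C) (EFinM (4 * c)); apply: lee_wpmul2l; first by rewrite lee_fin mulr_ge0.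
  apply: le_trans (HC _ _ st); rewrite le_eqVlt; apply/orP; left; apply/eqP.
  by apply: eq_sqint => u; ring.
have K0 : 0 <= 4 * c * C by rewrite !mulr_ge0.
have B := ae_dyadic_bound d0 l0 K0 mY sY.
(* [Ld t] and [Y t] agree a.s. only for each fixed [t]; the dyadic points are countable, so one null
   set serves them all, and continuity of the path does the rest. *)
have E : {ae P, forall w n k j, Ld (- n.+1%:R + j%:R / 2 ^+ k) w =
    (Gamma (d + 1))^-1 * Y (- n.+1%:R + j%:R / 2 ^+ k) w}.
  apply: ae_foralln => n; apply: ae_foralln => k; apply: ae_foralln => j.
  exact: (HY _).2.
apply: filterS3 cont B E => w cw [B B0 BP] EP.
apply: (@dyadic_growth _ _ lam (`|(Gamma (d + 1))^-1| * B) (2^-1 `^ (d / 2))) => //.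
- by rewrite mulr_ge0.
- have e1 : 1 `^ (d / 2) = 1 :> R by rewrite powR1.
  by rewrite powR_ge0/= -[X in _ < X]e1 gt0_ltr_powR ?divr_gt0// ?nnegrE//; lra.
- move=> n k j jk; rewrite /dyadic_incr !EP -mulrBr normrM -!mulrA ler_wpM2l//.
  by rewrite mulrA; exact: BP.
Qed.

End Growth.

Theorem theorem4p4 (R : realType) (disp : measure_display)
  (T : measurableType disp) (P : probability T R)
  (P_complete : measure_is_complete P)
  (d p : R) (hd : 0 < d < 2^-1) (hp : 1 <= p < 2)
  (L Ld : R -> T -> R)
  (Ld_flp : is_flp P d L Ld) (Ld_pvar : bounded_p_variation P p Ld)
  (a b : \bar R) (mu sigma psi : R -> R) (lam : R)
  (h_sp : strongly_proper a b mu sigma psi lam) :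
  [set transformed_OU (state_space_transform a b psi lam) lam Ld tau W
    | tau in [set: R] & W in [set W | forall w, open_itv a b (W w)]]
  `<=` solutions P p a b mu sigma Ld.
Proof.
move=> _ [tau _ [W _ <-]].
have growth := flp_growth P_complete hd (sp_lam_gt0 h_sp) Ld_flp.
have [_ _ cont _] := Ld_flp.
(* The three events concern the paths of [Ld] alone; on their intersection the pathwise result holds
   for every [tau] and every real initial value, in particular the one given by [W w]. *)
apply: filterS3 cont Ld_pvar growth => w cw pw [D HD].
exact: (OU_solution h_sp hp cw pw HD).
Qed.
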